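(* Let $\alpha\in[0,1)$, and let $G$ be a connected unicyclic graph of order $n$ with exactly $k$ pendant vertices, where $1\le k\le n-3$. Then $$\rho_\alpha(G)\le \rho_\alpha(U_n(3,k)),$$ and equality holds if and only if $G\cong U_n(3,k)$.
   Context: All graphs are finite, simple and connected. For a graph $G$ with adjacency matrix $A(G)$ and diagonal degree matrix $D(G)$, put $A_\alpha(G)=\alpha D(G)+(1-\alpha)A(G)$; $\rho_\alpha(G)$ denotes the largest eigenvalue of $A_\alpha(G)$. A connected graph is unicyclic if it has exactly one cycle. A pendant vertex is a vertex of degree $1$. For integers $t\ge 3$ and $1\le k\le n-t$, $U_n(t,k)$ denotes the unicyclic graph of order $n$ obtained from a cycle $C_t$ of length $t$ by attaching, at one single vertex of $C_t$, $k$ pendant paths of almost equal lengths: their lengths $l_1,\dots,l_k\ge 1$ (numbers of edges) satisfy $l_1+\dots+l_k=n-t$ and $|l_i-l_j|\le 1$ for all $i,j$, and the paths share pairwise only the vertex of attachment. *)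

(* Defs.v *)
From HB Require Import structures.
From mathcomp Require Import all_boot all_order all_algebra.
From mathcomp Require Import classical_sets reals.
From mathcomp Require Import zify.

Set Implicit Arguments.
Unset Strict Implicit.
Unset Printing Implicit Defensive.

Import Order.TTheory GRing.Theory Num.Theory.

Record sgraph := SGraph {
  vertex :> finType;
  adj : rel vertex;
  adj_sym : symmetric adj;
  adj_irr : irreflexive adj }.

Definition giso (G H : sgraph) : Prop :=
  exists2 f : G -> H, bijective f & forall x y, adj (f x) (f y) = adj x y.

Definition connected_graph (G : sgraph) : Prop :=
  forall x y : G, connect (@adj G) x y.

Definition degree (G : sgraph) (x : G) : nat := #|[pred y | adj x y]|.

Definition pendant (G : sgraph) : pred G := [pred x | degree x == 1].
Arguments pendant : clear implicits.

Section Cycles.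
Local Open Scope set_scope.

(* A cycle is a subgraph, hence is identified with its set of edges: the
   rotations and the reversal of a vertex sequence give the same cycle. *)
Definition cycle_edges (G : sgraph) (p : seq G) : {set {set G}} :=
  [set:: [seq [set x; next p x] | x <- p]].

Definition is_cycle (G : sgraph) (C : {set {set G}}) : Prop :=
  exists p : seq G,
    [/\ 3 <= size p, ucycle (@adj G) p & C = cycle_edges p].

End Cycles.

Definition unicyclic (G : sgraph) : Prop :=
  connected_graph G /\ exists! C : {set {set G}}, is_cycle C.

Section Spectrum.
Local Open Scope ring_scope.

Definition adjmx (R : realType) (G : sgraph) : 'M[R]_#|G| :=
  \matrix_(i, j) (adj (enum_val i) (enum_val j))%:R.

Definition degmx (R : realType) (G : sgraph) : 'M[R]_#|G| :=
  diag_mx (\row_i (degree (enum_val i))%:R).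

Definition Aalpha (R : realType) (alpha : R) (G : sgraph) : 'M[R]_#|G| :=
  alpha *: degmx R G + (1 - alpha) *: adjmx R G.

(* The set of eigenvalues is finite, and nonempty when G has a vertex since
   the matrix is symmetric: the supremum is then the largest eigenvalue. *)
Definition rho (R : realType) (alpha : R) (G : sgraph) : R :=
  sup [set a : R | eigenvalue (Aalpha alpha G) a]%classic.

End Spectrum.

(* The cycle C_t (for t >= 3) on 'I_t, with k paths of lengths l_0, ..., l_(k-1)
   attached at its vertex 0. The vertex [inr (Tagged _ s)] over i : 'I_k is the
   vertex at distance s + 1 from the attachment point on the i-th path. *)
Section CyclePaths.
Variables (t k : nat) (l : 'I_k -> nat).

Definition cp_vertex : finType := ('I_t + {i : 'I_k & 'I_(l i)})%type.

Definition cp_adj (x y : cp_vertex) : bool :=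
  match x, y with
  | inl i, inl j =>
      (i != j) && ((i.+1 %% t == j :> nat) || (j.+1 %% t == i :> nat))
  | inl i, inr u | inr u, inl i =>
      (i == 0 :> nat) && (tagged u == 0 :> nat)
  | inr u, inr v =>
      (tag u == tag v) && (((tagged u).+1 == tagged v :> nat)
                           || ((tagged v).+1 == tagged u :> nat))
  end.

Lemma cp_adj_sym : symmetric cp_adj.
Proof.
by move=> [i|u] [j|v] //=; rewrite eq_sym orbC.
Qed.

Lemma cp_adj_irr : irreflexive cp_adj.
Proof.
by move=> [i|u] /=; rewrite eqxx //= orbb; apply/negbTE; rewrite neq_ltn ltnSn orbT.
Qed.

Definition cycle_paths : sgraph := SGraph cp_adj_sym cp_adj_irr.

Lemma card_cycle_paths : #|cycle_paths| = t + \sum_i l i.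
Proof.
rewrite /= card_sum card_ord card_tagged sumnE big_map big_enum /=.
by congr addn; apply: eq_bigr => i _; rewrite card_ord.
Qed.

End CyclePaths.

(* For 1 <= k <= m these are, up to order, the only k positive lengths of sum m
   that differ pairwise by at most 1. *)
Definition path_len (m k : nat) (i : 'I_k) : nat := m %/ k + (i < m %% k).

Lemma path_len_gt0 m k (i : 'I_k) : k <= m -> 0 < path_len m i.
Proof.
move=> km; rewrite addn_gt0 divn_gt0 ?km //.
exact: leq_ltn_trans (ltn_ord i).
Qed.

Lemma path_len_almost_equal m k (i j : 'I_k) :
  path_len m i <= (path_len m j).+1.
Proof. by rewrite /path_len; case: (i < _); case: (j < _); lia. Qed.

Lemma sum_path_len m k : 0 < k -> \sum_(i < k) path_len m i = m.
Proof.
move=> k0; rewrite big_split /= sum_nat_const card_ord -big_mkcond /=.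
have lt := ltn_pmod m k0.
rewrite sum1_card.
rewrite (_ : #|_| = m %% k); first by rewrite mulnC -divn_eq.
rewrite -sum1_card (big_ord_narrow (ltnW lt)) sum1_card card_ord //.
Qed.

Definition U (n t k : nat) : sgraph := cycle_paths t (@path_len (n - t) k).

Lemma card_U n t k : t <= n -> 0 < k -> #|U n t k| = n.
Proof. by move=> tn k0; rewrite card_cycle_paths sum_path_len // subnKC. Qed.

(* Main.v *)
Require Import Defs.
From HB Require Import structures.
From mathcomp Require Import all_boot all_order all_algebra.
From mathcomp Require Import boolp classical_sets reals.
From mathcomp Require Import topology normedtype derive.
From mathcomp Require Import ring lra zify.

(* Let G maximize the spectral radius among the connected graphs on a fixed
   vertex set with as many edges as vertices and k pendant vertices, let x be
   its Perron vector and v a vertex where x is maximal.  A modification of G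
   within this class that does not decrease the quadratic form of A_alpha at x
   must keep x as an eigenvector; this excludes the following modifications.
   If u <> v had degree at least 3, a child w of u in a breadth-first tree
   rooted at v could be detached from u and attached to v.  Hence v is the only
   branching vertex, and x is strictly maximal there.
   Let b_0 = v, ..., b_q be a pendant path and a_0 = v, a_1, ... another walk
   leaving v.  From x(b_0) > x(a_1) one gets x(b_s) > x(a_(s+1)) for every s:
   at the first failure the edges b_s b_(s+1) and a_(s+1) a_(s+2) could be
   replaced with b_s a_(s+2) and a_(s+1) b_(s+1).  If the walk a outruns the
   path b, then the edge a_(q+1) a_(q+2) could be replaced with b_q a_(q+2).
   So the lengths of two pendant paths differ by at most 1.  If a runs around a
   cycle of length t > 3 and does not outrun b, then x(b_(t-1)) > x(a_t) = x(v)
   contradicts the choice of v; hence the cycle is a triangle. *)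

Set Implicit Arguments.
Unset Strict Implicit.
Unset Printing Implicit Defensive.
Import Order.TTheory GRing.Theory Num.Theory.
Import numFieldNormedType.Exports.

(** * Graphs given by relations, and the move of one edge *)

Lemma degreeE (G : sgraph) (x : G) : (degree x = \sum_y adj x y)%N.
Proof. by rewrite /degree -sum1_card big_mkcond. Qed.

Lemma giso_sym (G H : sgraph) : giso G H -> giso H G.
Proof.
case=> f [g fK gK] fadj; exists g; first by exists f.
by move=> x y; rewrite -fadj !gK.
Qed.

(** Symmetrizing and dropping loops turns every relation into a graph, so that the graphs on a fixed
    vertex type are indexed by a finite set. *)
Definition symrel (T : eqType) (e : rel T) : rel T :=
  fun x y => (x != y) && (e x y || e y x).

Lemma symrel_sym (T : eqType) (e : rel T) : symmetric (symrel e).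
Proof. by move=> x y; rewrite /symrel eq_sym orbC. Qed.

Lemma symrel_irr (T : eqType) (e : rel T) : irreflexive (symrel e).
Proof. by move=> x; rewrite /symrel eqxx. Qed.

Definition graph_of_rel (T : finType) (e : rel T) : sgraph :=
  SGraph (@symrel_sym T e) (@symrel_irr T e).

(** The deletion names both orientations of the edge and the addition only one, because
    [graph_of_rel] symmetrizes. *)
Definition move_edge (G : sgraph) (w u v : G) : sgraph :=
  graph_of_rel (fun x y : G =>
    adj x y && ~~ ((x == u) && (y == w) || (x == w) && (y == u))
    || (x == v) && (y == w)).

Lemma sum_eq_op (T : finType) (z : T) : \sum_x (x == z : nat) = 1.
Proof. by rewrite (bigD1 z) //= eqxx big1 // => y /negbTE ->. Qed.

Section EdgeMove.
Variables (G : sgraph) (w u v : G).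
Hypotheses (uw : adj u w) (vw : ~~ adj v w) (v_w : v != w).

Lemma move_edgeE (x y : G) : @adj (move_edge w u v) x y =
  [|| adj x y && ~~ ((x == u) && (y == w) || (x == w) && (y == u)),
      (x == v) && (y == w) | (x == w) && (y == v)].
Proof.
rewrite {1}/adj /= /symrel (adj_sym y x).
have [<-|/= xy] := eqVneq x y; last first.
  by case: (adj x y); case: (x == u); case: (x == w); case: (x == v);
     case: (y == u); case: (y == w); case: (y == v).
rewrite adj_irr /= andbC orbb; apply/esym/negbTE.
by apply/negP => /andP[/eqP xv /eqP xw]; move: v_w; rewrite -xv xw eqxx.
Qed.

(** Stated without subtraction: summed over [y] it yields degrees, and cast into a ring it yields
    the change of the operator. *)
Lemma move_edge_count (x y : G) :
  @adj (move_edge w u v) x y + (x == u) * (y == w) + (x == w) * (y == u)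
  = adj x y + (x == v) * (y == w) + (x == w) * (y == v).
Proof.
rewrite move_edgeE.
have u_w : u != w by apply: contraTneq uw => ->; rewrite adj_irr.
have u_v : u != v by apply: contraNneq vw => <-.
have [->|xw] := eqVneq x w.
  rewrite ![w == _]eq_sym (negbTE u_w) (negbTE v_w) /=.
  have [->|yu] := eqVneq y u; first by rewrite (negbTE u_v) adj_sym uw.
  have [->|yv] := eqVneq y v; first by rewrite adj_sym (negbTE vw).
  by case: adj; rewrite ?muln0.
have [->|yw] := eqVneq y w; last first.
  by rewrite !andbF; case: adj; case: (x == u); case: (x == v).
have [->|xu] := eqVneq x u; first by rewrite (negbTE u_v) uw.
have [->|xv] := eqVneq x v; first by rewrite (negbTE vw).
by case: adj; rewrite ?muln0.
Qed.

Lemma degree_move_edge (x : G) :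
  @degree (move_edge w u v) x + (x == u) = degree x + (x == v).
Proof.
have : \sum_y (@adj (move_edge w u v) x y + (x == u) * (y == w) + (x == w) * (y == u))
    = \sum_y (adj x y + (x == v) * (y == w) + (x == w) * (y == v)).
  by apply: eq_bigr => y _; apply: move_edge_count.
rewrite !big_split /=.
rewrite -[X in X + _ + _ = _](@degreeE (move_edge w u v)) -degreeE.
have delta (a b : G) : \sum_y (x == a) * (y == b) = (x == a).
  by rewrite -big_distrr /= sum_eq_op muln1.
rewrite !delta; lia.
Qed.

(** Only the edge [u w] is lost, and the new edge ties [w] to [v]; a connection from [u] to [v]
    therefore replaces it. *)
Lemma move_edge_connected : connected_graph G ->
  connect (@adj (move_edge w u v)) u v -> connected_graph (move_edge w u v).
Proof.
move=> conG cuv.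
have csym := sym_connect_sym (@adj_sym (move_edge w u v)).
have cwv : connect (@adj (move_edge w u v)) w v.
  by apply: connect1; rewrite move_edgeE !eqxx !orbT.
suff sub : forall x y : G, adj x y -> connect (@adj (move_edge w u v)) x y.
  by move=> x y; apply: connect_sub (conG x y) => a b; apply: sub.
have cuw : connect (@adj (move_edge w u v)) u w.
  by apply: connect_trans cuv _; rewrite csym.
move=> x y xy.
have [/orP[]/andP[/eqP-> /eqP->]|h] :=
  boolP ((x == u) && (y == w) || (x == w) && (y == u)) => //.
  by rewrite csym.
by apply: connect1; rewrite move_edgeE xy h.
Qed.

End EdgeMove.

(** The degree sum says that there are as many edges as vertices; unlike the uniqueness of a cycle,
    this is visibly preserved by edge moves. *)
Definition unicyclic_class (k : nat) (G : sgraph) : Prop :=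
  [/\ connected_graph G, (\sum_x @degree G x = 2 * #|G|)%N & #|pendant G| = k].

Lemma connect_walk (T : finType) (e : rel T) (a : nat -> T) (n : nat) :
  (forall i, (i < n)%N -> e (a i) (a i.+1)) -> connect e (a 0%N) (a n).
Proof.
elim: n => [|n IH] H; first exact: connect0.
apply: connect_trans (IH _) (connect1 (H n (ltnSn n))) => i ilt.
exact/H/ltnW.
Qed.

Lemma card_pendantE (G : sgraph) : #|pendant G| = (\sum_x (@degree G x == 1))%N.
Proof.
by rewrite -sum1_card big_mkcond; apply: eq_bigr => x _; rewrite inE; case: eqP.
Qed.

Lemma sum_degree_move_edge (G : sgraph) (w u v : G) :
  adj u w -> ~~ adj v w -> v != w ->
  (\sum_x @degree (move_edge w u v) x = \sum_x @degree G x)%N.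
Proof.
move=> uw vw v_w.
have : (\sum_x (@degree (move_edge w u v) x + (x == u))
    = \sum_x (@degree G x + (x == v)))%N.
  by apply: eq_bigr => x _; apply: degree_move_edge.
by rewrite !big_split /= !sum_eq_op => /addIn.
Qed.

(** An equality and not just an isomorphism, by proof irrelevance of the two graph axioms; it lets
    [G] itself compete among the graphs [graph_of_rel e]. *)
Lemma graph_of_adj (G : sgraph) : graph_of_rel (@adj G) = G.
Proof.
case: G => T e es ei; rewrite /graph_of_rel /=.
have E : symrel e = e.
  apply/funext => x; apply/funext => y; rewrite /symrel (es y x) orbb.
  by case: eqP => [->|]; rewrite ?ei.
move: (@symrel_sym T e) (@symrel_irr T e); rewrite E => s' i'.
by congr SGraph; apply: Prop_irrelevance.
Qed.

(** * Breadth-first trees *)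

(** The default [p v = v] makes every iterate of [p] meaningful. *)
Record bfs (G : sgraph) (v : G) (d : G -> nat) (p : G -> G) : Prop := Bfs {
  bfs_root : d v = 0;
  bfs_parent_root : p v = v;
  bfs_parent : forall x, x != v -> adj x (p x) /\ d x = (d (p x)).+1;
  bfs_adj : forall x y, adj x y -> d y <= (d x).+1 }.

(** The depth is the least length of a walk from [v]; the last vertex but one of a shortest walk
    serves as parent. *)
Lemma bfs_exists (G : sgraph) (v : G) : connected_graph G ->
  exists d p, @bfs G v d p.
Proof.
move=> conG.
pose walk x n := [exists t : n.-tuple G, path (@adj G) v t && (last v t == x)].
have walkP x : exists n, walk x n.
  have /connectP[s ps ->] := conG v x.
  exists (size s); apply/existsP; exists (in_tuple s).
  by rewrite ps /=.
pose d x := ex_minn (walkP x).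
have dle x s : path (@adj G) v s -> last v s = x -> d x <= size s.
  move=> ps ls; rewrite /d; case: ex_minnP => n _; apply.
  by apply/existsP; exists (in_tuple s); rewrite ps ls /=.
have dwalk x : exists2 s, path (@adj G) v s & last v s = x /\ size s = d x.
  rewrite /d; case: ex_minnP => n /existsP[t /andP[pt /eqP lt]] _.
  by exists t => //; rewrite size_tuple.
have parent x : exists y, (x != v -> adj x y /\ d x = (d y).+1) /\ (x = v -> y = v).
  have [->|xv] := eqVneq x v; first by exists v.
  have [s ps [ls sz]] := dwalk x.
  case: (lastP s) ps ls sz => [|s' z]; first by move=> _ /= e; rewrite e eqxx in xv.
  rewrite rcons_path last_rcons size_rcons => /andP[ps' az] ez sz; subst z.
  exists (last v s'); split=> [_|e]; last by rewrite e eqxx in xv.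
  split; first by rewrite adj_sym.
  have le1 := dle _ _ ps' erefl.
  have [s2 ps2 [ls2 sz2]] := dwalk (last v s').
  have := dle x (rcons s2 x); rewrite rcons_path ps2 ls2 az last_rcons size_rcons.
  by move=> /(_ isT erefl); lia.
pose p x := projT1 (cid (parent x)).
have H x : (x != v -> adj x (p x) /\ d x = (d (p x)).+1) /\ (x = v -> p x = v).
  exact: projT2 (cid (parent x)).
exists d, p; split.
- by have := dle v [::]; rewrite /= => /(_ isT erefl); lia.
- by have [_ ->] := H v.
- by move=> x; have [] := H x.
- move=> x y xy; have [s ps [ls sz]] := dwalk x.
  rewrite -sz -(size_rcons s y); apply: dle; last by rewrite last_rcons.
  by rewrite rcons_path ps ls.
Qed.

Section BfsTree.
Variables (G : sgraph) (v : G) (d : G -> nat) (p : G -> G).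
Hypothesis T : bfs v d p.
Implicit Types x y z : G.

Definition tree_adj x y := (x != v) && (p x == y) || (y != v) && (p y == x).

Lemma tree_adj_sym : symmetric tree_adj.
Proof. by move=> x y; rewrite /tree_adj orbC. Qed.

Lemma tree_adjW x y : tree_adj x y -> adj x y.
Proof.
case/orP=> /andP[xv /eqP <-]; first by have [] := bfs_parent T xv.
by rewrite adj_sym; have [] := bfs_parent T xv.
Qed.

Lemma bfs_depth0 x : (d x == 0) = (x == v).
Proof.
have [->|xv] := eqVneq x v; first by rewrite (bfs_root T).
by have [_ ->] := bfs_parent T xv.
Qed.

Lemma bfs_depth_parent x : d (p x) = (d x).-1.
Proof.
have [->|xv] := eqVneq x v; first by rewrite (bfs_parent_root T) (bfs_root T).
by have [_ ->] := bfs_parent T xv.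
Qed.

Lemma tree_connect x y : connect tree_adj x y.
Proof.
suff cv z : connect tree_adj z v.
  by apply: connect_trans (cv x) _; rewrite (sym_connect_sym tree_adj_sym).
have [n] := ubnP (d z); elim: n z => // n IH z dz.
have [->|zv] := eqVneq z v; first exact: connect0.
apply: connect_trans (IH (p z) _); last by rewrite bfs_depth_parent;
  move: dz; rewrite -(bfs_depth0 z) in zv; lia.
by apply: connect1; rewrite /tree_adj zv eqxx.
Qed.

(** Every vertex but the root owns the edge to its parent, and no edge is owned twice since the
    depth drops towards the parent. *)
Lemma sum_tree_adj : \sum_x \sum_y tree_adj x y = 2 * (#|G| - 1).
Proof.
have split_ x y : tree_adj x y = (x != v) && (p x == y) + (y != v) && (p y == x) :> nat.
  rewrite /tree_adj.
  have [/andP[xv /eqP <-]|_] := boolP ((x != v) && (p x == y)); last by [].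
  have [/andP[_ /eqP ppx]|//] := boolP (_ && (_ == x)).
  have := bfs_depth_parent x; have := bfs_depth_parent (p x); rewrite ppx.
  by move: xv; rewrite -bfs_depth0; lia.
have half : \sum_x \sum_y ((x != v) && (p x == y) : nat) = #|G| - 1.
  transitivity (\sum_x (x != v : nat)).
    apply: eq_bigr => x _; case: (x == v) => /=; first by rewrite big1.
    rewrite (bigD1 (p x)) //= eqxx big1 ?addn0 // => y.
    by rewrite eq_sym => /negbTE ->.
  rewrite subn1 -(cardC1 v) -sum1_card [RHS]big_mkcond /=.
  by apply: eq_bigr => x _; rewrite inE; case: (_ == _).
under eq_bigr do under eq_bigr do rewrite split_.
under eq_bigr do rewrite big_split.
by rewrite big_split /= half exchange_big /= half mul2n addnn.
Qed.

(** Ordered pairs, so that a chord counts twice, as it does in the degree sum. *)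
Definition chords : {set G * G} := [set u | adj u.1 u.2 && ~~ tree_adj u.1 u.2].

Lemma card_chords : \sum_x @degree G x = 2 * (#|G| - 1) + #|chords|.
Proof.
have -> : #|chords| = \sum_x \sum_y ((x, y) \in chords).
  rewrite -sum1_card big_mkcond pair_bigA /=.
  by apply: eq_bigr => -[x y] _; case: (_ \in _).
rewrite -sum_tree_adj -big_split; apply: eq_bigr => x _.
rewrite degreeE -big_split; apply: eq_bigr => y _; rewrite inE /=.
have := @tree_adjW x y; case: tree_adj => [->|_] //=.
by rewrite andbT add0n.
Qed.

Lemma chords_sym x y : ((x, y) \in chords) = ((y, x) \in chords).
Proof. by rewrite !inE /= adj_sym tree_adj_sym. Qed.

Lemma unique_chord : \sum_x @degree G x = 2 * #|G| ->
  exists a b, [/\ adj a b, ~~ tree_adj a b &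
    forall x y, adj x y = [|| tree_adj x y, (x == a) && (y == b) | (x == b) && (y == a)]].
Proof.
move=> degs; have G0 : 0 < #|G| by apply/card_gt0P; exists v.
have c2 : #|chords| = 2 by have := card_chords; lia.
have [[a b] abc] : exists u, u \in chords by apply/card_gt0P; rewrite c2.
have bac : (b, a) \in chords by rewrite chords_sym.
move: (abc); rewrite inE /= => /andP[ab nab].
have ne : (a, b) != (b, a).
  by apply/negP => /eqP[e _]; rewrite e adj_irr in ab.
have e : [set (a, b); (b, a)] = chords.
  apply/eqP; rewrite eqEcard cards2 ne c2 leqnn andbT.
  apply/fintype.subsetP => u; rewrite !inE => /orP[]/eqP -> /=.
    by rewrite ab nab.
  by rewrite adj_sym tree_adj_sym ab nab.
exists a, b; split=> // x y.
have [t|nt] /= := boolP (tree_adj x y); first exact: tree_adjW.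
have -> : adj x y = ((x, y) \in chords) by rewrite inE /= nt andbT.
by rewrite -e !inE !xpair_eqE.
Qed.

(** This is the fundamental cycle of a chord: the tree path from [a] to [b], closed by the chord. *)
Lemma chord_cycle a b : (a, b) \in chords ->
  exists2 C : {set {set G}}, is_cycle C &
    [set a; b]%SET \in C /\
    forall x y, (x, y) \in chords -> [set x; y]%SET \in C ->
      [set x; y]%SET = [set a; b]%SET.
Proof.
rewrite inE /= => /andP[ab nab].
have /connectP[q0 pq0] := tree_connect a b; case/shortenP: pq0 => q pq uq _ lq.
case: (lastP q) pq uq lq => [|q' z] pq uq lq.
  by move: ab; rewrite lq /= adj_irr.
rewrite last_rcons in lq; subst z.
have q'0 : q' != [::].
  by apply: contraNneq nab => e; move: pq; rewrite e /= andbT.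
pose c := b :: a :: q'.
(* All steps of [c] follow the tree except the one from [b] to [a]; [e'] keeps track of this and so
   excludes any other chord. *)
pose e' x y := tree_adj x y || ((x == b) && (y == a)).
have cyc : cycle e' c.
  rewrite /= rcons_path.
  move: pq; rewrite rcons_path => /andP[pq1 lq].
  rewrite {1}/e' !eqxx orbT /=; apply/andP; split; last by rewrite /e' lq.
  by apply: sub_path pq1 => x y; rewrite /e' => ->.
have uc : uniq c by move: uq; rewrite -rcons_cons rcons_uniq.
exists (cycle_edges c).
  exists c; split => //; first by rewrite /c; case: q' q'0 {pq uq c cyc uc}.
  apply/andP; split=> //; apply: sub_cycle cyc => x y /orP[/tree_adjW //|].
  by case/andP=> /eqP-> /eqP->; rewrite adj_sym.
split.
  rewrite inE; apply/mapP; exists b; first by rewrite inE eqxx.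
  by rewrite /= eqxx finset.setUC.
move=> x y xyc; rewrite inE => /mapP[z zc exy].
rewrite exy; have := next_cycle cyc zc; set z' := next c z in exy *.
case/orP=> [tz|/andP[/eqP-> /eqP->]]; last by rewrite finset.setUC.
have zc' : (z, z') \notin chords by rewrite inE tz andbF.
have : x \in [set z; z']%SET by rewrite -exy !inE eqxx.
have : y \in [set z; z']%SET by rewrite -exy !inE eqxx orbT.
have xy : x != y by apply: contraTneq xyc => ->; rewrite inE adj_irr.
rewrite !inE => /orP[]/eqP ey /orP[]/eqP ex; move: xy xyc zc'; rewrite ex ey ?eqxx //.
  by rewrite chords_sym => _ ->.
by move=> _ ->.
Qed.

(** A deepest vertex of the cycle has two distinct neighbours on it. A tree neighbour that is not
    deeper can only be the parent, so the two edges cannot both belong to the tree. *)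
Lemma cycle_has_chord (q : seq G) : 3 <= size q -> ucycle (@adj G) q ->
  exists u, u \in chords.
Proof.
move=> sq /andP[cq uq].
case: q sq cq uq => // x0 q1; set q := x0 :: q1 => sq cq uq.
case: (@arg_maxnP G x0 (mem q) d); first by rewrite !inE eqxx.
move=> z zq zmax.
have [i s es] := rot_to zq.
have smax y : y \in z :: s -> d y <= d z.
  by rewrite -es mem_rot => ys; apply: zmax.
move: cq uq sq; rewrite -(rot_cycle i) -(rot_uniq i) -(size_rot i) es.
case: s es smax => // y1 [|y2 s] // es smax cyc uniqs _.
pose y := last y2 s.
have zy1 : adj z y1 by case/andP: cyc.
have yz : adj z y.
  rewrite adj_sym; move: cyc; rewrite /= rcons_path => /and3P[_ _ /andP[_]].
  by [].
have y1y : y1 != y.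
  apply: contraTneq uniqs => ->; rewrite /= /y mem_last /=.
  by rewrite !andbF.
apply/existsP; apply: contraT; rewrite negb_exists => /forallP nochord.
have par x : x \in [:: z, y1, y2 & s] -> adj z x -> p z = x.
  move=> xs zx; have := nochord (z, x); rewrite inE /= zx /= negbK.
  case/orP=> /andP[xv /eqP // pxz].
  have := smax x xs; have := bfs_depth_parent x; rewrite pxz.
  by move: xv; rewrite -bfs_depth0; lia.
have e1 : p z = y1 by apply: par => //; rewrite !inE eqxx orbT.
have e2 : p z = y.
  by apply: par => //; rewrite inE; apply/orP; right; rewrite inE mem_last orbT.
by rewrite -e1 e2 eqxx in y1y.
Qed.

End BfsTree.

(** The given cycle has a chord; two different chords would yield two different fundamental cycles.
    Hence [chords] consists of the two orientations of one edge. *)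
Lemma unicyclic_sum_degree (G : sgraph) :
  unicyclic G -> \sum_x @degree G x = 2 * #|G|.
Proof.
case=> conG [C [[q [sq cq _]] uniqC]].
have [v _] : exists v : G, v \in q.
  by case: q sq cq => // x q _ _; exists x; rewrite inE eqxx.
have [d [p T]] := bfs_exists v conG.
have [[a b] abc] := cycle_has_chord T sq cq.
have [C1 cC1 [abC1 C1P]] := chord_cycle T abc.
have ab : adj a b by move: abc; rewrite inE => /andP[].
have ne : (a, b) != (b, a) by apply/negP => /eqP[e _]; rewrite e adj_irr in ab.
have e : chords v p = [set (a, b); (b, a)]%SET.
  apply/setP => -[x y]; apply/idP/idP => [xyc|]; last first.
    by rewrite !in_set2 => /orP[]/eqP -> //; rewrite chords_sym.
  have [C2 cC2 [xyC2 _]] := chord_cycle T xyc.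
  move: xyC2; rewrite -(uniqC _ cC2) (uniqC _ cC1) => /(C1P _ _ xyc) exy.
  have : x \in [set a; b]%SET by rewrite -exy !inE eqxx.
  have : y \in [set a; b]%SET by rewrite -exy !inE eqxx orbT.
  have xy : x != y by apply: contraTneq xyc => ->; rewrite inE adj_irr.
  rewrite !inE => /orP[]/eqP ey /orP[]/eqP ex; move: xy; rewrite ex ey ?eqxx //= ?orbT //.
have G0 : 0 < #|G| by apply/card_gt0P; exists v.
by rewrite (card_chords T) e cards2 ne; lia.
Qed.

(** * Legs of a unicyclic graph with one branching vertex *)

(** Each length is the minimum or one more, and fewer than [k] of them exceed it; so the minimum and
    the number of longer ones are the quotient and the remainder of the sum by [k]. The permutation
    lists the longer ones first. *)
Lemma balanced_path_len (k : nat) (l : 'I_k -> nat) : 0 < k ->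
  (forall i j, l i <= (l j).+1) ->
  exists2 s : 'I_k -> 'I_k, injective s &
    forall i, l (s i) = path_len (\sum_j l j) i.
Proof.
move=> k0 bal.
have i0 := Ordinal k0.
case: (@arg_minnP _ i0 predT l) => // im _ lmin.
pose A := [set i | l i != l im]%SET.
have lE i : l i = l im + (i \in A).
  rewrite inE; have := bal i im; have := lmin i isT.
  by case: (eqVneq (l i) (l im)) => /=; lia.
have sumE : \sum_j l j = l im * k + #|A|.
  under eq_bigr do rewrite lE.
  rewrite big_split /= sum_nat_const card_ord mulnC -sum1_card [X in _ = _ + X]big_mkcond.
  by congr (_ + _); apply: eq_bigr => i _; case: (i \in A).
have Ak : #|A| < k.
  rewrite -[X in _ < X]card_ord -cardsT; apply: proper_card.
  rewrite fintype.properE finset.subsetT /=.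
  by apply/fintype.subsetPn; exists im; rewrite ?inE ?eqxx.
pose e := enum A ++ enum (~: A)%SET.
have size_e : size e = k by rewrite size_cat -!cardE cardsC card_ord.
have uniq_e : uniq e.
  rewrite cat_uniq !enum_uniq andbT /=; apply/hasPn => x.
  by rewrite !mem_enum inE.
exists (fun i => nth i0 e i).
  move=> i j /eqP; rewrite nth_uniq ?size_e // => /eqP; exact: val_inj.
move=> i; rewrite /path_len sumE lE divnMDl // modnMDl divn_small // modn_small // addn0.
congr (_ + nat_of_bool _).
rewrite nth_cat -cardE; case: ltnP => iA.
  by rewrite -mem_enum mem_nth // -cardE.
apply/negbTE; rewrite -finset.in_setC -mem_enum mem_nth // -cardE.
by rewrite -(ltn_add2l #|A|) cardsC card_ord subnKC.
Qed.

Lemma degree_ge2 (G : sgraph) (x y z : G) :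
  adj x y -> adj x z -> y != z -> 2 <= degree x.
Proof.
move=> xy xz yz; have <- : #|[set y; z]%SET| = 2 by rewrite cards2 yz.
apply: subset_leq_card; apply/fintype.subsetP => u.
by rewrite !inE => /orP[]/eqP ->.
Qed.

Lemma degree_ge3 (G : sgraph) (x y z t : G) :
  adj x y -> adj x z -> adj x t -> y != z -> y != t -> z != t -> 2 < degree x.
Proof.
move=> xy xz xt yz yt zt.
have <- : #|(y |: [set z; t])%SET| = 3 by rewrite cardsU1 cards2 zt !inE negb_or yz yt.
apply: subset_leq_card; apply/fintype.subsetP => u.
by rewrite !inE => /or3P[]/eqP ->.
Qed.

Section Legs.
Variables (G : sgraph) (v : G) (d : G -> nat) (p : G -> G) (ca cb : G).
Hypothesis T : bfs v d p.
Hypotheses (chord : adj ca cb) (chordN : ~~ tree_adj v p ca cb).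
Hypothesis adjE : forall x y, adj x y =
  [|| tree_adj v p x y, (x == ca) && (y == cb) | (x == cb) && (y == ca)].
Hypothesis degree_le2 : forall u, u != v -> degree u <= 2.
Hypothesis degree_root : 1 < degree v.

Let dp := bfs_depth_parent T.
Let d0 := bfs_depth0 T.

Lemma adj_parent x : x != v -> adj x (p x).
Proof. by case/(bfs_parent T). Qed.

Lemma depthS x : x != v -> d x = (d (p x)).+1.
Proof. by case/(bfs_parent T). Qed.

(** A neighbour of the root has depth 1, hence the root as its parent. *)
Lemma chord_neq_root x y : adj x y -> ~~ tree_adj v p x y -> x != v.
Proof.
move=> xy; apply: contraNneq => xv.
have yv : y != v by apply: contraTneq xy => ->; rewrite xv adj_irr.
have := bfs_adj T xy; rewrite xv (bfs_root T) => dy.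
rewrite /tree_adj yv eqxx /= -d0; move: (depthS yv) dy; clear; lia.
Qed.

Lemma ca_neq_root : ca != v.
Proof. exact: chord_neq_root chordN. Qed.

Lemma cb_neq_root : cb != v.
Proof. by apply: (@chord_neq_root _ ca); rewrite 1?adj_sym // tree_adj_sym. Qed.

Lemma ca_neq_cb : ca != cb.
Proof. by apply: contraTneq chord => ->; rewrite adj_irr. Qed.

(** Two children together with the parent would give degree 3 away from the root. *)
Lemma child_inj x y : x != v -> y != v -> p x != v -> p x = p y -> x = y.
Proof.
move=> xv yv pxv e; apply/eqP; apply: contraT => xy.
have := degree_le2 pxv; rewrite leqNgt => /negP; case.
have far z : z != v -> p (p z) != z.
  move=> zv; apply/negP => /eqP ez; have := dp (p z); have := depthS zv.
  by rewrite ez; clear; lia.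
apply: (@degree_ge3 _ _ (p (p x)) x y) => //.
- exact: adj_parent.
- by rewrite adj_sym adj_parent.
- by rewrite e adj_sym adj_parent.
- exact: far.
- by rewrite e far.
Qed.

(** The leaves of the tree; they turn out to be the pendant vertices and the two ends of the
    chord. *)
Definition leg_end z := z != v /\ forall x, x != v -> p x != z.

(** The parent and the other end of the chord already exhaust the degree, which leaves no room for a
    child. *)
Lemma chord_leg_end x y : adj x y -> ~~ tree_adj v p x y -> leg_end x.
Proof.
move=> xy nxy; have xv := chord_neq_root xy nxy; split=> // z zv.
apply/negP => /eqP e; have := degree_le2 xv; rewrite leqNgt => /negP; case.
apply: (@degree_ge3 _ _ (p x) z y) => //.
- exact: adj_parent.
- by rewrite -e adj_sym adj_parent.
- apply/negP => /eqP ez; have := dp x; have := depthS zv; rewrite e ez; clear; lia.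
- by apply: contraNneq nxy => <-; rewrite /tree_adj xv eqxx.
- by apply: contraNneq nxy => <-; rewrite /tree_adj zv e eqxx orbT.
Qed.

Lemma ca_end : leg_end ca.
Proof. exact: chord_leg_end chordN. Qed.

Lemma cb_end : leg_end cb.
Proof. by apply: (@chord_leg_end _ ca); rewrite 1?adj_sym // tree_adj_sym. Qed.

Lemma pendant_leg_end z : pendant G z -> [/\ leg_end z, z != ca & z != cb].
Proof.
move=> /eqP dz.
have lt2 : ~ 1 < degree z by rewrite dz.
have zv : z != v by apply/negP => /eqP zv; apply: lt2; rewrite zv.
split.
- split=> // x xv; apply/negP => /eqP e; apply: lt2.
  apply: (@degree_ge2 _ _ (p z) x); first exact: adj_parent.
    by rewrite -e adj_sym adj_parent.
  by apply/negP => /eqP ez; have := dp z; have := depthS xv; rewrite e ez; clear; lia.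
- apply/negP => /eqP e; apply: lt2.
  apply: (@degree_ge2 _ _ (p z) cb); [exact: adj_parent|by rewrite e|].
  by apply: contraNneq chordN => <-; rewrite /tree_adj e eqxx -e zv.
- apply/negP => /eqP e; apply: lt2.
  apply: (@degree_ge2 _ _ (p z) ca); [exact: adj_parent|by rewrite e adj_sym|].
  by apply: contraNneq chordN => <-; rewrite /tree_adj e eqxx -e zv orbT.
Qed.

Lemma leg_end_nbr z y : leg_end z -> adj z y ->
  [\/ y = p z, z = ca /\ y = cb | z = cb /\ y = ca].
Proof.
move=> [zv zE]; rewrite adjE.
case/or3P=> [/orP[]/andP[yv /eqP e]|/andP[/eqP-> /eqP->]|/andP[/eqP-> /eqP->]].
- by apply: Or31.
- by have := zE _ yv; rewrite e eqxx.
- by apply: Or32.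
- by apply: Or33.
Qed.

Lemma leg_end_pendant z : leg_end z -> z != ca -> z != cb -> pendant G z.
Proof.
move=> ez za zb; change (degree z == 1); rewrite eqn_leq; apply/andP; split; last first.
  by apply/card_gt0P; exists (p z); rewrite inE adj_parent //; case: ez.
rewrite -(card1 (p z)); apply: subset_leq_card; apply/fintype.subsetP => y.
rewrite !inE => /(leg_end_nbr ez)[-> //|[e _]|[e _]].
  by rewrite e eqxx in za.
by rewrite e eqxx in zb.
Qed.

(* For i <= d z: the vertex at distance i from the root on the way to z. *)
Definition leg z i := iter (d z - i) p z.

Lemma depth_leg z i : i <= d z -> d (leg z i) = i.
Proof.
have it n : d (iter n p z) = d z - n.
  by elim: n => [|n IH]; rewrite ?subn0 // iterS dp IH; clear; lia.
by move=> iz; rewrite /leg it subKn.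
Qed.

Lemma leg0 z : leg z 0 = v.
Proof. by apply/eqP; rewrite -d0 depth_leg. Qed.

Lemma leg_depth z : leg z (d z) = z.
Proof. by rewrite /leg subnn. Qed.

Lemma parent_leg z i : i < d z -> p (leg z i.+1) = leg z i.
Proof.
by move=> iz; rewrite /leg -iterS subnSK.
Qed.

Lemma leg_neq_root z i : 0 < i <= d z -> leg z i != v.
Proof. by case/andP=> i0 iz; rewrite -d0 depth_leg // -lt0n. Qed.

Lemma leg_inj z i j : i <= d z -> j <= d z -> leg z i = leg z j -> i = j.
Proof. by move=> iz jz e; rewrite -(depth_leg iz) e depth_leg. Qed.

(** From a common vertex, [child_inj] identifies the legs step by step away from the root; as an end
    has no child, both legs stop together. *)
Lemma leg_end_inj z z' i j : leg_end z -> leg_end z' ->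
  0 < i <= d z -> 0 < j <= d z' -> leg z i = leg z' j -> z = z'.
Proof.
move=> ez ez' iz jz; rewrite /leg; have := leg_neq_root iz; rewrite /leg.
have root n : iter n p v = v by elim: n => //= n ->; rewrite (bfs_parent_root T).
have nroot y n : iter n p y != v -> y != v by apply: contraNneq => ->; rewrite root.
move: (d z - i) (d z' - j) => s t.
have [zv zE] := ez; have [zv' zE'] := ez'.
elim: s t => [|s IH] [|t] //= nv e.
- have tv : iter t p z' != v by apply: (@nroot _ 1); rewrite /= -e.
  by have := zE _ tv; rewrite e eqxx.
- have sv : iter s p z != v by apply: (@nroot _ 1).
  by have := zE' _ sv; rewrite e eqxx.
- have sv : iter s p z != v by apply: (@nroot _ 1).
  apply: (IH t) => //; apply: child_inj => //.
  by apply: (@nroot _ 1); rewrite /= -e.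
Qed.

Lemma leg_adj z i : i < d z -> adj (leg z i) (leg z i.+1).
Proof.
by move=> iz; rewrite -parent_leg // adj_sym adj_parent // leg_neq_root.
Qed.

Lemma leg_nbr z i y : 0 < i < d z -> adj (leg z i) y ->
  y = leg z i.-1 \/ y = leg z i.+1.
Proof.
case/andP=> i0 iz.
have iv : leg z i != v by apply: leg_neq_root; rewrite i0 ltnW.
have i1v : leg z i.+1 != v by apply: leg_neq_root.
have ni x : leg_end x -> leg z i != x.
  by case=> _ xE; rewrite -parent_leg // xE.
rewrite adjE (negbTE (ni _ ca_end)) (negbTE (ni _ cb_end)) orbF.
case/orP=> /andP[yv /eqP e].
  by left; rewrite -e -[in LHS](prednK i0) parent_leg // prednK // ltnW.
by right; apply: child_inj; rewrite // e // parent_leg.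
Qed.

(** A deepest descendant of [x] has no child, so it ends a leg through [x]. *)
Lemma leg_cover x : x != v ->
  exists2 z, leg_end z & exists2 i, 0 < i <= d z & x = leg z i.
Proof.
move=> xv.
pose below y := [exists i : 'I_(d y).+1, iter i p y == x].
have belowx : below x by apply/existsP; exists ord0.
have root n : iter n p v = v by elim: n => //= n ->; rewrite (bfs_parent_root T).
case: (@arg_maxnP _ x below d belowx) => z /existsP[[i iz] /= /eqP zx] zmax.
have zv : z != v by apply: contraNneq xv => e; rewrite -zx e root.
exists z.
  split=> // c cv; apply/negP => /eqP e.
  have dc := depthS cv; rewrite e in dc.
  suff : below c by move=> /zmax; rewrite dc ltnn.
  have ic : i.+1 < (d c).+1 by rewrite dc.
  by apply/existsP; exists (Ordinal ic); rewrite /= -iterS iterSr e zx.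
exists (d z - i); last by rewrite /leg subKn.
rewrite leq_subr andbT lt0n; apply: contraNneq xv => e.
rewrite -zx -d0; have := depth_leg (leq_subr i (d z)).
by rewrite /leg subKn // => ->; rewrite e.
Qed.

End Legs.

(** * Isomorphism with a triangle carrying pendant paths *)

Section LegsIso.
Variables (G : sgraph) (v : G) (d : G -> nat) (p : G -> G) (ca cb : G).
Hypothesis T : bfs v d p.
Hypotheses (chord : adj ca cb) (chordN : ~~ tree_adj v p ca cb).
Hypothesis adjE : forall x y, adj x y =
  [|| tree_adj v p x y, (x == ca) && (y == cb) | (x == cb) && (y == ca)].
Hypothesis degree_le2 : forall u, u != v -> degree u <= 2.
Hypothesis degree_root : 1 < degree v.
Hypotheses (dca : d ca = 1) (dcb : d cb = 1).
Variables (k : nat) (h : 'I_k -> G).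
Hypotheses (h_inj : injective h) (h_pendant : forall i, pendant G (h i)).
Hypothesis h_cover : forall z, pendant G z -> exists i, z = h i.

Local Notation leg := (leg d p).

(** The chord ends, both at depth 1, form the triangle with the root; position [s] on a path goes to
    depth [s + 1]. *)
Definition leg_map (x : cycle_paths 3 (fun i => d (h i))) : G :=
  match x with
  | inl i => if i == 0 :> nat then v else if i == 1 :> nat then ca else cb
  | inr u => leg (h (tag u)) (tagged u).+1
  end.

Let h_end i : leg_end v p (h i).
Proof. by have [] := pendant_leg_end T chord chordN degree_root (h_pendant i). Qed.

Let pos i (j : 'I_(d (h i))) : 0 < j.+1 <= d (h i).
Proof. by rewrite ltn_ord. Qed.

Let leg_ca : leg ca 1 = ca.
Proof. by rewrite -[in leg _ 1]dca leg_depth. Qed.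

Let leg_cb : leg cb 1 = cb.
Proof. by rewrite -[in leg _ 1]dcb leg_depth. Qed.

Let leg_h_neq_ca i (j : 'I_(d (h i))) : leg (h i) j.+1 != ca.
Proof.
have [_ + _] := pendant_leg_end T chord chordN degree_root (h_pendant i).
apply: contraNneq; rewrite -{1}leg_ca => e; apply/eqP.
by apply: (leg_end_inj T degree_le2) e; rewrite ?dca //; exact: (ca_end T chord).
Qed.

Let leg_h_neq_cb i (j : 'I_(d (h i))) : leg (h i) j.+1 != cb.
Proof.
have [_ _] := pendant_leg_end T chord chordN degree_root (h_pendant i).
apply: contraNneq; rewrite -{1}leg_cb => e; apply/eqP.
by apply: (leg_end_inj T degree_le2) e; rewrite ?dcb //; exact: (cb_end T chord).
Qed.

Let leg_h_neq_root i (j : 'I_(d (h i))) : leg (h i) j.+1 != v.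
Proof. exact: (leg_neq_root T). Qed.

Let ca_v := ca_neq_root T chord chordN.
Let cb_v := cb_neq_root T chord chordN.
Let ca_cb := ca_neq_cb chord.

Lemma leg_map_inj : injective leg_map.
Proof.
have ord3 (i j : 'I_3) : leg_map (inl i) = leg_map (inl j) -> i = j.
  case: i j => [[|[|[|//]]] ?] [[|[|[|//]]] ?] /= e; try exact: val_inj;
  by move: ca_v cb_v ca_cb; rewrite ?e ?eqxx -?e ?eqxx.
have mix (i : 'I_3) u : leg_map (inl i) != leg_map (inr u).
  case: u => u j; rewrite /= eq_sym.
  by case: ifP => _; [|case: ifP].
case=> [i|[u s]] [j|[w t]] e.
- by rewrite (ord3 _ _ e).
- by have := mix i (existT _ w t); rewrite e eqxx.
- by have := mix j (existT _ u s); rewrite e eqxx.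
- move: e; rewrite /= => e.
  have uw : u = w by apply: h_inj; apply: (leg_end_inj T degree_le2) e.
  subst w; have [st] := leg_inj T (ltn_ord s) (ltn_ord t) e.
  by rewrite (val_inj st).
Qed.

Lemma leg_map_surj y : exists x, leg_map x = y.
Proof.
have [->|yv] := eqVneq y v; first by exists (inl (@Ordinal 3 0 isT)).
have [z ez [i iz ->]] := leg_cover T yv.
have [e|za] := eqVneq z ca.
  exists (inl (@Ordinal 3 1 isT)); move: iz; rewrite e dca /= -{1}leg_ca.
  by case: i => [|[|]].
have [e|zb] := eqVneq z cb.
  exists (inl (@Ordinal 3 2 isT)); move: iz; rewrite e dcb /= -{1}leg_cb.
  by case: i => [|[|]].
have [u e] := h_cover (leg_end_pendant T adjE ez za zb).
subst z; case: i iz => // i iz.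
by exists (inr (existT _ u (Ordinal iz))).
Qed.

Lemma leg_map_adj x y : adj (leg_map x) (leg_map y) = adj x y.
Proof.
have root_ca : adj v ca.
  by have := @leg_adj _ _ _ _ T ca 0; rewrite dca (leg0 T) leg_ca; apply.
have root_cb : adj v cb.
  by have := @leg_adj _ _ _ _ T cb 0; rewrite dcb (leg0 T) leg_cb; apply.
have cyc (i j : 'I_3) : adj (leg_map (inl i)) (leg_map (inl j)) =
    cp_adj (inl i : cp_vertex 3 (fun i => d (h i))) (inl j).
  case: i j => [[|[|[|//]]] ?] [[|[|[|//]]] ?] //=; rewrite ?adj_irr //.
  - by rewrite adj_sym.
  - by rewrite adj_sym.
  - by rewrite adj_sym.
have mix (i : 'I_3) u (s : 'I_(d (h u))) :
    adj (leg_map (inl i)) (leg (h u) s.+1) = (i == 0 :> nat) && (s == 0 :> nat).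
  have nbr z : leg_end v p z -> p z = v -> z = ca \/ z = cb ->
      adj z (leg (h u) s.+1) = false.
    move=> ez pz zc; apply/negP => /(leg_end_nbr adjE ez)[e|[_ e]|[_ e]].
    - by have := leg_h_neq_root s; rewrite e pz eqxx.
    - by have := leg_h_neq_cb s; rewrite e eqxx.
    - by have := leg_h_neq_ca s; rewrite e eqxx.
  have par z : z != v -> d z = 1 -> p z = v.
    by move=> _ dz; apply/eqP; rewrite -(bfs_depth0 T) (bfs_depth_parent T) dz.
  case: i => [[|[|[|//]]] ?] /=.
  - apply/idP/idP => [/(bfs_adj T)|/eqP s0].
      by rewrite (bfs_root T) (depth_leg T) //; lia.
    by have := leg_adj T (ltn_ord s); rewrite s0 (leg0 T).
  - by apply: nbr; [exact: (ca_end T chord)|exact: par|left].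
  - by apply: nbr; [exact: (cb_end T chord)|exact: par|right].
case: x y => [i|[u s]] [j|[w t]].
- exact: cyc.
- exact: mix.
- by rewrite adj_sym [RHS]adj_sym; exact: mix.
(* Passing to the parent never changes the leg, and lowers the position by one. *)
have up i j (s' : 'I_(d (h i))) (t' : 'I_(d (h j))) :
    p (leg (h i) s'.+1) = leg (h j) t'.+1 -> i = j /\ s' = t'.+1 :> nat.
  rewrite parent_leg // => e.
  have s0 : 0 < s'.
    rewrite lt0n; apply: contraNneq (leg_h_neq_root t') => s0.
    by rewrite -e s0 (leg0 T).
  have ij : i = j.
    apply: h_inj; apply: (leg_end_inj T degree_le2) e => //.
    by rewrite s0 ltnW.
  subst j; split=> //; apply: (leg_inj T) e => //.
  exact: ltnW.
apply/idP/idP => /=.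
  rewrite adjE => /or3P[/orP[]/andP[_ /eqP e]|/andP[/eqP e]|/andP[/eqP e]].
  - by have [uw st] := up _ _ _ _ e; rewrite -st eqxx orbT andbT; apply/eqP.
  - by have [uw st] := up _ _ _ _ e; rewrite -st eqxx andbT eq_sym; apply/eqP.
  - by have := leg_h_neq_ca s; rewrite e eqxx.
  - by have := leg_h_neq_cb s; rewrite e eqxx.
case/andP=> /eqP uw; subst w; case/orP=> /eqP e.
  by rewrite -e; apply: (leg_adj T); rewrite e.
by rewrite adj_sym -e; apply: (leg_adj T); rewrite e.
Qed.

Lemma leg_map_giso : giso (cycle_paths 3 (fun i => d (h i))) G.
Proof.
exists leg_map; last exact: leg_map_adj.
have bij : #|G| <= #|cycle_paths 3 (fun i => d (h i))|.
  have surj y : exists x, leg_map x == y.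
    by case: (leg_map_surj y) => x <-; exists x.
  have gK : cancel (fun y => xchoose (surj y)) leg_map.
    by move=> y; apply/eqP/(xchooseP (surj y)).
  exact: leq_card (can_inj gK).
exact: inj_card_bij leg_map_inj bij.
Qed.

End LegsIso.

Local Open Scope ring_scope.

(** * The spectral radius of A_alpha *)

Lemma sum_delta (R : pzRingType) (T : finType) (z : T) (F : T -> R) :
  \sum_x (x == z)%:R * F x = F z.
Proof.
rewrite (bigD1 z) //= eqxx mul1r big1 ?addr0 // => y /negbTE ->.
by rewrite mul0r.
Qed.

Lemma quadratic_ge0_linear0 (R : realFieldType) (b p : R) :
  (forall t, 0 <= b * t + p * t ^+ 2) -> b = 0.
Proof.
move=> H; apply/eqP; case: eqP => // /eqP b0; exfalso.
have p0 : 0 <= p.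
  have := H 1; have := H (-1); rewrite sqrrN expr1n; lra.
have p1 : p + 1 != 0 by lra.
(* Dividing by [p + 1] instead of the minimizing [2 * p] avoids the case [p = 0]; the value stays a
   negated square. *)
have := H (- b / (p + 1)).
have -> : b * (- b / (p + 1)) + p * (- b / (p + 1)) ^+ 2
   = - ((b / (p + 1)) ^+ 2).
  by field.
rewrite oppr_ge0 => h; have : (b / (p + 1)) ^+ 2 == 0 by rewrite eq_le h sqr_ge0.
by rewrite sqrf_eq0 mulf_eq0 invr_eq0 (negbTE b0) (negbTE p1).
Qed.

Lemma continuous_bigsum (R : realType) (V : topologicalType) (I : finType)
    (F : I -> V -> R) :
  (forall i, continuous (F i)) -> continuous (fun v => \sum_i F i v).
Proof.
move=> cF; rewrite unlock; elim: (index_enum I) => [|i s IHs] /= v.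
  exact: cvg_cst.
by apply: cvgD; [exact: cF | exact: IHs].
Qed.

Definition quad (R : pzRingType) (T : finType) (M : T -> T -> R) (f : T -> R) : R :=
  \sum_x f x * \sum_y M x y * f y.

(** The unit sphere is compact and the form continuous; homogeneity extends the bound to every [f].
    Row vectors carry the topology. *)
Lemma quad_sphere_max (R : realType) (T : finType) (M : T -> T -> R) :
  (0 < #|T|)%N ->
  exists2 c : T -> R, \sum_x c x ^+ 2 = 1 &
  forall f, quad M f <= quad M c * \sum_x f x ^+ 2.
Proof.
move=> T0.
pose n := #|T|.
pose fn (v : 'rV[R]_n) : T -> R := fun x => v ord0 (enum_rank x).
pose S := [set v : 'rV[R]_n | \sum_x fn v x ^+ 2 = 1]%classic.
have cfn x : continuous (fun v : 'rV[R]_n => fn v x : R).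
  exact: coord_continuous.
(* The sphere is a closed subset of the cube with coordinates in [[-1, 1]]. *)
have cS : compact S.
  apply: (@subclosed_compact _ _
     [set v : 'rV[R]_n | forall i, `[-1 : R, 1]%classic (v ord0 i)]%classic).
  - have -> : S = ((fun v : 'rV[R]_n => \sum_x fn v x ^+ 2) @^-1` [set x : R | x = 1])%classic.
      by [].
    apply: preimage_closed; last exact: closed_eq.
    move=> v _; apply: continuous_bigsum => x {}v.
    exact: (cvgM (cfn x v) (cfn x v)).
  - by apply: (@rV_compact _ _ (fun=> `[-1 : R, 1]%classic)) => i; apply: segment_compact.
  - move=> v /= Sv i; rewrite /= in_itv /= -ler_norml.
    have : fn v (enum_val i) ^+ 2 <= 1.
      by rewrite -Sv (bigD1 (enum_val i)) //= lerDl sumr_ge0 // => y _; apply: sqr_ge0.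
    rewrite /fn enum_valK -[X in X <= _ -> _]real_normK ?num_real //.
    by rewrite expr_le1.
have [x0 _] : exists x0 : T, x0 \in T by apply/card_gt0P.
pose g (v : 'rV[R]_n) := quad M (fn v).
have cg : {within S, continuous g}%classic.
  apply: continuous_subspaceT; apply: continuous_bigsum => x.
  have cMfn : continuous (fun v => \sum_y M x y * fn v y).
    apply: continuous_bigsum => y v.
    exact: (cvgM (cvg_cst _) (cfn y v)).
  move=> v; exact: (cvgM (cfn x v) (cMfn v)).
pose vof (f : T -> R) : 'rV[R]_n := \row_i f (enum_val i).
have vofK f : fn (vof f) = f.
  by apply/funext => x; rewrite /fn /vof mxE enum_rankK.
have S0 : (S !=set0)%classic.
  exists (vof (fun x => (x == x0)%:R)); rewrite /S /= vofK.
  rewrite (bigD1 x0) //= eqxx expr1n big1 ?addr0 // => y /negbTE ->.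
  by rewrite expr0n.
have [c] := EVT_max_rV S0 cS cg.
rewrite inE => cSc maxc.
exists (fn c); first exact: cSc.
move=> f.
have [f0|f0] := eqVneq (\sum_x f x ^+ 2) 0.
  have {}f0 x : f x = 0.
    have := f0 => /eqP; rewrite psumr_eq0; last by move=> ? _; apply: sqr_ge0.
    by move/allP/(_ x); rewrite mem_index_enum sqrf_eq0 => /(_ isT)/eqP.
  rewrite {1}/quad big1 => [|x _]; last by rewrite f0 mul0r.
  by rewrite big1 ?mulr0 // => x _; rewrite f0 expr0n.
have fp : 0 < \sum_x f x ^+ 2.
  by rewrite lt_def f0 sumr_ge0 // => x _; apply: sqr_ge0.
set s := Num.sqrt (\sum_x f x ^+ 2).
have s2 : s ^+ 2 = \sum_x f x ^+ 2 by rewrite sqr_sqrtr // ltW.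
have s0 : s != 0 by rewrite -sqrf_eq0 s2.
have := maxc (vof (fun x => f x / s)).
rewrite /g vofK => /(_ _).
have -> : vof (fun x => f x / s) \in S.
  rewrite inE /S /= vofK.
  under eq_bigr do rewrite exprMn.
  by rewrite -mulr_suml -s2 -exprMn divff // expr1n.
move=> /(_ isT).
have -> : quad M (fun x => f x / s) = quad M f / s ^+ 2.
  rewrite /quad mulr_suml; apply: eq_bigr => x _.
  under eq_bigr do rewrite mulrA.
  by rewrite -mulr_suml; field.
by rewrite ler_pdivrMr ?s2.
Qed.

(** First variation: adding [t] to the value of [c] at [z] makes the gap in the inequality a
    nonnegative polynomial in [t] without constant term, so its linear coefficient vanishes. *)
Lemma quad_max_eigen (R : realFieldType) (T : finType) (M : T -> T -> R)
    (l : R) (c : T -> R) :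
  (forall x y, M x y = M y x) ->
  (forall f, quad M f <= l * \sum_x f x ^+ 2) ->
  quad M c = l * \sum_x c x ^+ 2 ->
  forall x, \sum_y M x y * c y = l * c x.
Proof.
move=> symM le eqc z.
pose h t x := c x + t * (x == z)%:R.
have delta (F : T -> R) := sum_delta z F.
have sq t : \sum_x h t x ^+ 2 = \sum_x c x ^+ 2 + 2 * t * c z + t ^+ 2.
  rewrite -(delta (fun x => 2 * t * c x)) -(delta (fun x => t ^+ 2)).
  rewrite -!big_split /=; apply: eq_bigr => x _; rewrite /h.
  by case: (x == z) => /=; ring.
have qu t : quad M (h t) = quad M c + 2 * t * (\sum_y M z y * c y) + t ^+ 2 * M z z.
  have e1 : quad M (h t) = \sum_x \sum_y M x y * h t x * h t y.
    apply: eq_bigr => x _; rewrite mulr_sumr; apply: eq_bigr => y _.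
    by ring.
  have e2 : quad M c = \sum_x \sum_y M x y * c x * c y.
    apply: eq_bigr => x _; rewrite mulr_sumr; apply: eq_bigr => y _.
    by ring.
  have e3 : \sum_y M z y * c y = \sum_x \sum_y (x == z)%:R * M x y * c y.
    rewrite -(delta (fun x => \sum_y M x y * c y)).
    by apply: eq_bigr => x _; rewrite mulr_sumr; apply: eq_bigr => y _; ring.
  have e4 : \sum_y M z y * c y = \sum_x \sum_y (y == z)%:R * M x y * c x.
    rewrite exchange_big /= -(delta (fun x => \sum_y M x y * c y)).
    apply: eq_bigr => x _; rewrite mulr_sumr; apply: eq_bigr => y _.
    by rewrite (symM y x); ring.
  have e5 : M z z = \sum_x \sum_y (x == z)%:R * ((y == z)%:R * M x y).
    under eq_bigr do rewrite -mulr_sumr.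
    by rewrite delta delta.
  have -> u : 2 * t * u = t * u + t * u by ring.
  rewrite {1}e3 e4 e5 e1 e2.
  rewrite !mulr_sumr -!big_split /=; apply: eq_bigr => x _.
  rewrite !mulr_sumr -!big_split /=; apply: eq_bigr => y _.
  by rewrite /h; ring.
apply/eqP; rewrite -subr_eq0; apply/eqP.
suff : 2 * (l * c z - \sum_y M z y * c y) = 0 by lra.
apply: (@quadratic_ge0_linear0 _ _ (l - M z z)) => t.
have := le (h t); rewrite sq qu eqc -subr_ge0 => /le_trans; apply.
by rewrite le_eqVlt; apply/orP; left; apply/eqP; ring.
Qed.

Section AlphaOperator.
Variables (R : realType) (alpha : R).
Implicit Types G H : sgraph.

(** The matrix [Aalpha] acting on functions, with the degree term spread over the incident edges, so
    that moving an edge changes single summands. *)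
Definition aop G (f : G -> R) (x : G) : R :=
  \sum_y (adj x y)%:R * (alpha * f x + (1 - alpha) * f y).

Definition aentry G (x y : G) : R :=
  alpha * ((x == y)%:R * (degree x)%:R) + (1 - alpha) * (adj x y)%:R.

Lemma sum_aentry G (f : G -> R) (x : G) : \sum_y aentry x y * f y = aop f x.
Proof.
rewrite /aop /aentry.
under eq_bigr do rewrite mulrDl.
under [RHS]eq_bigr do rewrite mulrDr.
rewrite !big_split /=; congr (_ + _); last first.
  by apply: eq_bigr => y _; ring.
rewrite (bigD1 x) //= eqxx mul1r big1 ?addr0 => [|y /negbTE]; last first.
  by rewrite eq_sym => ->; rewrite mul0r mulr0 mul0r.
by rewrite -mulr_suml degreeE natr_sum; ring.
Qed.

Lemma aentry_sym G (x y : G) : aentry x y = aentry y x.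
Proof.
rewrite /aentry adj_sym eq_sym; case: eqP => [->|] //=.
by rewrite !mul0r.
Qed.

Lemma quad_aentry G (f : G -> R) : quad (@aentry G) f = \sum_x f x * aop f x.
Proof. by apply: eq_bigr => x _; rewrite sum_aentry. Qed.

(** The library's eigenvectors are rows multiplied from the left; the symmetry of [aentry] turns
    them into functions acted on by [aop]. *)
Lemma eigenvalue_aop G (a : R) :
  eigenvalue (Aalpha alpha G) a <->
  exists2 f : G -> R, (exists x, f x != 0) & forall x, aop f x = a * f x.
Proof.
have mulE (v : 'rV[R]_#|G|) j :
    (v *m Aalpha alpha G) ord0 j
    = aop (fun x => v ord0 (enum_rank x)) (enum_val j).
  rewrite mxE -sum_aentry (reindex (@enum_val G G)) /=; last first.
    by apply: onW_bij; apply: enum_val_bij.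
  apply: eq_bigr => i _; rewrite enum_valK mulrC; congr (_ * _).
  rewrite !mxE aentry_sym /aentry (inj_eq enum_val_inj); case: eqP => [->|_].
    by rewrite mulr1n mul1r.
  by rewrite mulr0n mul0r.
split.
  case/eigenvalueP => v eqv v0.
  exists (fun x => v ord0 (enum_rank x)).
    have /rV0Pn[i vi] := v0.
    by exists (enum_val i); rewrite enum_valK.
  by move=> x; have := mulE v (enum_rank x); rewrite eqv enum_rankK mxE => <-.
case=> f [x0 fx0] eqf; apply/eigenvalueP; exists (\row_i f (enum_val i)).
  apply/rowP => j; rewrite mulE !mxE -eqf; congr (aop _ _).
  by apply/funext => x; rewrite mxE enum_rankK.
by apply/rV0Pn; exists (enum_rank x0); rewrite mxE enum_rankK.
Qed.

Lemma giso_rho G H : giso G H -> rho alpha G = rho alpha H.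
Proof.
have sub G1 H1 a : giso G1 H1 -> eigenvalue (Aalpha alpha H1) a ->
    eigenvalue (Aalpha alpha G1) a.
  case=> f bijf fadj /eigenvalue_aop[h [y hy] eqh]; apply/eigenvalue_aop.
  exists (h \o f).
    by case: bijf => g _ gK; exists (g y); rewrite /= gK.
  move=> x; rewrite /= -eqh /aop (reindex f); last exact: onW_bij.
  by apply: eq_bigr => z _; rewrite fadj.
move=> iso; rewrite /rho; congr sup; apply/seteqP; split=> a /=.
  exact/sub/giso_sym.
exact: sub.
Qed.

(** The maximum of the form on the sphere is an eigenvalue, and it bounds every other eigenvalue
    through the Rayleigh quotient; hence it is the supremum defining [rho]. *)
Lemma rho_maximizer G : (0 < #|G|)%N ->
  exists2 c : G -> R, \sum_x c x ^+ 2 = 1 &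
  quad (@aentry G) c = rho alpha G /\
  forall f, quad (@aentry G) f <= rho alpha G * \sum_x f x ^+ 2.
Proof.
move=> G0; have [c c1 cmax] := quad_sphere_max (@aentry G) G0.
have eqc := quad_max_eigen (@aentry_sym G) cmax.
suff e : rho alpha G = quad (@aentry G) c by exists c => //; rewrite e.
set l := quad _ c in cmax eqc *.
have ub : ubound [set a : R | eigenvalue (Aalpha alpha G) a]%classic l.
  move=> a /= /eigenvalue_aop[f [x fx] eqf].
  have := cmax f; rewrite quad_aentry.
  have -> : \sum_x f x * aop f x = a * \sum_x f x ^+ 2.
    by rewrite mulr_sumr; apply: eq_bigr => y _; rewrite eqf; ring.
  rewrite ler_pM2r // (bigD1 x) //=.
  rewrite ltr_wpDr ?sumr_ge0 // => [y _|]; first exact: sqr_ge0.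
  by rewrite lt_def sqr_ge0 sqrf_eq0 fx.
have inl : [set a : R | eigenvalue (Aalpha alpha G) a]%classic l.
  rewrite /=; apply/eigenvalue_aop; exists c.
    apply/existsP; apply: contraT; rewrite negb_exists => /forallP c0.
    have /eqP := c1; rewrite big1 => [|x _]; first by rewrite eq_sym oner_eq0.
    by have := c0 x; rewrite negbK => /eqP ->; rewrite expr0n.
  by move=> x; rewrite -sum_aentry eqc ?c1 ?mulr1.
apply/eqP; rewrite eq_le; apply/andP; split.
  by apply: ge_sup => //; exists l.
by apply: ub_le_sup => //; exists l.
Qed.

Lemma quad_le_rho G (f : G -> R) : (0 < #|G|)%N ->
  quad (@aentry G) f <= rho alpha G * \sum_x f x ^+ 2.
Proof. by case/rho_maximizer => ? _ [_]. Qed.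

Lemma quad_eq_rho G (f : G -> R) : (0 < #|G|)%N ->
  quad (@aentry G) f = rho alpha G * \sum_x f x ^+ 2 ->
  forall x, aop f x = rho alpha G * f x.
Proof.
move=> G0 eqf x; rewrite -sum_aentry; apply: quad_max_eigen eqf x.
  exact: aentry_sym.
by move=> g; apply: quad_le_rho.
Qed.

Hypothesis halpha : 0 <= alpha < 1.

(** Absolute values do not decrease the form, since the entries off the diagonal are nonnegative; so
    [|c|] is again an eigenvector. *)
Lemma perron G : (0 < #|G|)%N -> connected_graph G ->
  exists2 f : G -> R, (forall x, 0 < f x) &
    forall x, aop f x = rho alpha G * f x.
Proof.
case/andP: halpha => a0 a1 G0 conG.
have [c c1 [cmax le]] := rho_maximizer G0.
pose f x := `|c x|.
have sqf : \sum_x f x ^+ 2 = 1.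
  by rewrite -c1; apply: eq_bigr => x _; rewrite real_normK ?num_real.
have eqf : forall x, aop f x = rho alpha G * f x.
  apply: quad_eq_rho => //; apply/eqP; rewrite eq_le le /= sqf mulr1 -cmax.
  apply: ler_sum => x _; rewrite !mulr_sumr; apply: ler_sum => y _.
  have M0 : x != y -> 0 <= aentry x y.
    by move/negbTE; rewrite /aentry => ->; rewrite mul0r mulr0 add0r mulr_ge0 //; lra.
  have [<-|/M0 M0'] := eqVneq x y.
    rewrite /f (mulrCA `|_|) (mulrCA (c x)) -!expr2 real_normK ?num_real //.
  by rewrite mulrCA [X in _ <= X]mulrCA ler_wpM2l // -normrM ler_norm.
exists f => // x; rewrite lt_def normr_ge0 andbT; apply/negP => /eqP fx0.
(* At a zero of [f] the eigenvalue equation is a vanishing sum of nonnegative terms; as [alpha < 1],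
   the zero spreads to all neighbours, hence to the whole graph. *)
suff f0 y : f y = 0.
  by have := sqf; rewrite big1 ?(eq_sym, oner_eq0) => [/eqP|y _];
     rewrite ?(eq_sym 0) ?oner_eq0 // f0 expr0n.
have /connectP[p] := conG x y; elim: p x fx0 => [|z p IH] x fx0 /=; first by move=> _ ->.
case/andP=> xz; apply: IH.
have := eqf x; rewrite fx0 mulr0 => /eqP; rewrite psumr_eq0 => [|u _]; last first.
  by rewrite mulr_ge0 // fx0 mulr0 add0r mulr_ge0 ?normr_ge0 //; lra.
move/allP/(_ z); rewrite mem_index_enum => /(_ isT).
rewrite xz mul1r fx0 mulr0 add0r mulf_eq0 => /orP[|/eqP //].
by move=> /eqP h; exfalso; lra.
Qed.

End AlphaOperator.

(** * Effect of an edge move on the operator and its quadratic form *)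

Section MoveQuad.
Variables (R : realType) (alpha : R) (G : sgraph) (w u v : G).
Hypotheses (uw : adj u w) (vw : ~~ adj v w) (v_w : v != w).

Lemma aop_move_edge (f : G -> R) (x : G) :
  @aop _ alpha (move_edge w u v) f x = aop alpha f x
  + (x == v)%:R * (alpha * f v + (1 - alpha) * f w)
  - (x == u)%:R * (alpha * f u + (1 - alpha) * f w)
  + (x == w)%:R * ((1 - alpha) * (f v - f u)).
Proof.
pose g y := alpha * f x + (1 - alpha) * f y.
have -> : @aop _ alpha (move_edge w u v) f x = \sum_y ((adj x y)%:R * g y
    + (x == v)%:R * ((y == w)%:R * g y) + (x == w)%:R * ((y == v)%:R * g y)
    - (x == u)%:R * ((y == w)%:R * g y) - (x == w)%:R * ((y == u)%:R * g y)).
  apply: eq_bigr => y _; rewrite -/(g y).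
  have := move_edge_count uw vw v_w x y => /(congr1 (fun n => n%:R : R)).
  rewrite !natrD !natrM => h.
  rewrite !mulrA -!mulrDl -!mulrBl; congr (_ * _).
  by rewrite -h; ring.
rewrite !sumrB !big_split /= -!mulr_sumr !sum_delta /g -/(aop alpha f x).
case: (x =P v) => [xv|_]; case: (x =P u) => [xu|_]; case: (x =P w) => [xw|_];
  rewrite -?xv -?xu -?xw /=; ring.
Qed.

(** An edge [x y] contributes [alpha * (f x ^+ 2 + f y ^+ 2) + 2 * (1 - alpha) * f x * f y]; the
    square at [w] cancels between the old and the new edge. *)
Lemma quad_move_edge (f : G -> R) :
  quad (@aentry _ alpha (move_edge w u v)) f = quad (@aentry _ alpha G) f
  + alpha * (f v ^+ 2 - f u ^+ 2) + 2 * (1 - alpha) * f w * (f v - f u).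
Proof.
have delta (z : G) (c : R) : \sum_x f x * ((x == z)%:R * c) = f z * c.
  by under eq_bigr do rewrite mulrCA; rewrite (sum_delta z (fun x => f x * c)).
rewrite !quad_aentry.
pose A := alpha * f v + (1 - alpha) * f w.
pose B := alpha * f u + (1 - alpha) * f w.
pose C := (1 - alpha) * (f v - f u).
transitivity (\sum_x (f x * aop alpha f x + f x * ((x == v)%:R * A)
    + f x * ((x == u)%:R * - B) + f x * ((x == w)%:R * C))).
  apply: eq_bigr => x _; rewrite aop_move_edge.
  by rewrite /A /B /C; ring.
by rewrite !big_split /= !delta /A /B /C; ring.
Qed.

End MoveQuad.

(** * Maximizers of the spectral radius *)

Section Extremal.
Variables (R : realType) (alpha : R) (k : nat) (G : sgraph).
Hypotheses (halpha : 0 <= alpha < 1) (k_gt0 : (0 < k)%N).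
Hypothesis classG : unicyclic_class k G.
Hypothesis maxG : forall e : rel G,
  unicyclic_class k (graph_of_rel e) -> rho alpha (graph_of_rel e) <= rho alpha G.
Variables (f : G -> R) (v : G).
Hypotheses (f_gt0 : forall x, 0 < f x)
  (eq_f : forall x, aop alpha f x = rho alpha G * f x)
  (max_f : forall x, f x <= f v).

Lemma extremal_card_gt0 : (0 < #|G|)%N.
Proof. by apply/card_gt0P; exists v. Qed.

Lemma extremal_sqr_gt0 : 0 < \sum_x f x ^+ 2.
Proof.
rewrite (bigD1 v) //= ltr_wpDr ?sumr_ge0 // => [x _|]; first exact: sqr_ge0.
exact: exprn_gt0.
Qed.

(** The form of [G] at [f] attains its bound. If the new form is at least as large, maximality
    forces equal radii, and [f] attains the bound for the new graph as well. *)
Lemma extremal_aop (e : rel G) :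
  unicyclic_class k (graph_of_rel e) ->
  quad (@aentry _ alpha G) f <= quad (@aentry _ alpha (graph_of_rel e)) f ->
  forall x, @aop _ alpha (graph_of_rel e) f x = aop alpha f x.
Proof.
move=> cl le x.
have eqG : quad (@aentry _ alpha G) f = rho alpha G * \sum_x f x ^+ 2.
  by rewrite quad_aentry mulr_sumr; apply: eq_bigr => y _; rewrite eq_f; ring.
have leE := @quad_le_rho _ alpha (graph_of_rel e) f extremal_card_gt0.
have leM := maxG cl.
have eqrho : rho alpha (graph_of_rel e) = rho alpha G.
  apply: le_anti; apply/andP; split; first exact: leM.
  have := le_trans le leE; rewrite eqG (ler_pM2r extremal_sqr_gt0).
  exact.
have := @quad_eq_rho _ alpha (graph_of_rel e) f extremal_card_gt0.
rewrite eqrho eq_f; apply.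
apply/eqP; rewrite eq_le -{1}eqrho leE /= -eqG; exact: le.
Qed.

(** The form does not drop because [f u <= f z], yet the operator at [z] gains
    [alpha * f z + (1 - alpha) * f w > 0], against [extremal_aop]. *)
Lemma extremal_shift (w u z : G) :
  adj u w -> ~~ adj z w -> z != w -> f u <= f z ->
  connect (@adj (move_edge w u z)) u z ->
  #|pendant (move_edge w u z)| = k -> False.
Proof.
move=> uw zw z_w fuz cuz pk.
have [conG degG _] := classG.
have cl : unicyclic_class k (move_edge w u z).
  split=> //; first exact: move_edge_connected.
  by rewrite sum_degree_move_edge.
have z_u : z != u by apply: contraNneq zw => ->.
have fz := f_gt0 z; have fw := f_gt0 w; have fu := f_gt0 u.
have := extremal_aop cl _ z; rewrite quad_move_edge // aop_move_edge //.
rewrite eqxx (negbTE z_u) (negbTE z_w) => /(_ _) h.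
case/andP: halpha => a0 a1.
have : aop alpha f z + 1%:R * (alpha * f z + (1 - alpha) * f w)
     - 0%:R * (alpha * f u + (1 - alpha) * f w)
     + 0%:R * ((1 - alpha) * (f z - f u)) = aop alpha f z.
  apply: h; rewrite -addrA lerDl addr_ge0 //.
    by rewrite mulr_ge0 // subr_ge0 lerXn2r // nnegrE ltW.
  by rewrite mulr_ge0 ?subr_ge0 // mulr_ge0 ?ltW // mulr_gt0 // subr_gt0.
have : 0 <= alpha * f z by rewrite mulr_ge0 // ltW.
have : 0 < (1 - alpha) * f w by rewrite mulr_gt0 // subr_gt0.
by move: (aop alpha f z) (alpha * _) ((1 - alpha) * f w) => *; lra.
Qed.

Lemma aop_const1 (x : G) : aop alpha (fun=> 1) x = (degree x)%:R.
Proof.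
rewrite degreeE natr_sum; apply: eq_bigr => y _.
by rewrite !mulr1 addrCA subrr addr0 mulr1.
Qed.

(** The constant function has Rayleigh quotient 2; equality would make it an eigenvector and [G]
    2-regular, but [G] has a pendant vertex. *)
Lemma extremal_rho_gt2 : 2 < rho alpha G.
Proof.
have [conG degG pk] := classG.
have n0 : 0 < (#|G|)%:R :> R by rewrite ltr0n extremal_card_gt0.
have s1 : \sum_(x : G) (1 : R) ^+ 2 = (#|G|)%:R.
  by under eq_bigr do rewrite expr1n; rewrite sumr_const.
have q1 : quad (@aentry _ alpha G) (fun=> 1) = 2 * (#|G|)%:R.
  rewrite quad_aentry; under eq_bigr do rewrite aop_const1 mul1r.
  by rewrite -natr_sum degG natrM.
have := quad_le_rho alpha (fun=> 1) extremal_card_gt0.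
rewrite q1 s1 ler_pM2r // lt_def => ->; rewrite andbT.
apply/negP => /eqP rho2.
have := @quad_eq_rho _ alpha G (fun=> 1) extremal_card_gt0.
rewrite q1 s1 rho2 => /(_ erefl) deg2.
have [x] : exists x, x \in pendant G by apply/card_gt0P; rewrite pk.
rewrite inE => /eqP d1; have := deg2 x.
by rewrite aop_const1 d1; lra.
Qed.

(** At a maximum of [f] the eigenvalue equation bounds [rho] by the degree. *)
Lemma extremal_max_degree (x : G) : f x = f v -> (2 < degree x)%N.
Proof.
move=> fx; rewrite -(ltr_nat R).
apply: lt_le_trans extremal_rho_gt2 _.
rewrite -(ler_pM2r (f_gt0 x)) -eq_f degreeE natr_sum mulr_suml.
case/andP: halpha => a0 a1.
apply: ler_sum => y _; rewrite ler_wpM2l //.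
have : (1 - alpha) * f y <= (1 - alpha) * f x.
  by apply: ler_wpM2l; [rewrite subr_ge0 ltW | rewrite fx max_f].
lra.
Qed.

Lemma extremal_lt_max (x : G) : x != v -> (degree x <= 2)%N -> f x < f v.
Proof.
move=> xv dx; rewrite lt_def max_f andbT; apply/negP => /eqP e.
by have := extremal_max_degree (esym e); rewrite ltnNge dx.
Qed.

Lemma extremal_degree_le2 (u : G) : u != v -> (degree u <= 2)%N.
Proof.
move=> uv; rewrite leqNgt; apply/negP => degu.
have [conG degG pk] := classG.
have degv := extremal_max_degree (erefl (f v)).
have [d [p T]] := bfs_exists v conG.
have [a [b [_ _ adjE]]] := unique_chord T degG.
(* If [u] lies on the chord, [c] is its other end; otherwise the value is harmless. A third
   neighbour, different from [p u] and [c], must be a child of [u]. *)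
pose c := if u == a then b else a.
have [w uw] : exists2 w, adj u w & w \notin [set p u; c]%SET.
  apply/exists_inP; apply: contraLR degu; rewrite negb_exists -leqNgt => /forallP H.
  apply: leq_trans (_ : #|[set p u; c]%SET| <= 2)%N; last by rewrite cards2; case: eqP.
  apply: subset_leq_card; apply/fintype.subsetP => y; rewrite inE => uy.
  by have := H y; rewrite uy /= negbK.
rewrite !inE negb_or => /andP[wpu wc].
have [wv pw] : w != v /\ p w = u.
  move: uw; rewrite adjE /tree_adj => /or3P[/orP[]/andP[h1 /eqP h2]|h|h].
  - by rewrite h2 eqxx in wpu.
  - by [].
  - by case/andP: h => /eqP e1 /eqP e2; move: wc; rewrite /c e1 e2 eqxx /= eqxx.
  - case/andP: h => /eqP e1 /eqP e2; move: wc; rewrite /c e1 e2.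
    by case: (b =P a) => [->|_]; rewrite eqxx.
have dw : d w = (d u).+1 by have [_ ->] := bfs_parent T wv; rewrite pw.
have du : (0 < d u)%N by rewrite lt0n (bfs_depth0 T).
have vw : ~~ adj v w.
  by apply/negP => /(bfs_adj T); rewrite dw (bfs_root T); lia.
apply: (@extremal_shift w u v) => //; first by rewrite eq_sym.
(* Parents lead from depth at most [d u] to the root without meeting [w], which is deeper. *)
- suff H y : (d y <= d u)%N -> connect (@adj (move_edge w u v)) y v by exact: H.
  have [n] := ubnP (d y); elim: n y => // n IH y dn dy.
  have [->|yv] := eqVneq y v; first exact: connect0.
  have [ypy dpy] := bfs_parent T yv.
  have [dn' dy'] : (d (p y) < n)%N /\ (d (p y) <= d u)%N.
    by move: dn dy; rewrite dpy; clear; lia.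
  apply: connect_trans (IH (p y) dn' dy').
  apply: connect1; rewrite move_edgeE // 1?eq_sym //.
  rewrite ypy /=; apply/orP; left; apply/negP => /orP[]/andP[/eqP e1 /eqP e2].
    by move: dpy; rewrite e2 dw e1; clear; lia.
  by move: dy; rewrite e1 dw ltnn.
(* Both [u] and [v] have degree at least 3, so neither is pendant before or after the move. *)
- rewrite -pk !card_pendantE; apply: eq_bigr => x _.
  have := @degree_move_edge _ w u v uw vw; rewrite eq_sym wv => /(_ isT x).
  have [->|xu] := eqVneq x u; first by rewrite (negbTE uv); move: degu; clear; lia.
  by have [->|xv] := eqVneq x v; [move: degv; clear; lia | rewrite !addn0 => ->].
Qed.

(** Two successive moves keep all degrees, and the last hypothesis, a connection avoiding both
    edges, keeps each graph connected. The operator at [b1] drops by [(1 - alpha) * (f b0 - f a0)],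
    against [extremal_aop]. *)
Lemma extremal_switch (b0 b1 a0 a1 : G) :
  adj b0 b1 -> adj a0 a1 ->
  ~~ adj a0 b1 -> ~~ adj b0 a1 -> a0 != b1 -> b0 != a1 -> a0 != b0 -> a1 != b1 ->
  f a0 < f b0 -> f b1 <= f a1 ->
  connect [rel x y | adj x y && ~~ [|| (x == b0) && (y == b1), (x == b1) && (y == b0),
      (x == a0) && (y == a1) | (x == a1) && (y == a0)]] b0 a0 -> False.
Proof.
move=> bb aa a0b1 b0a1 ab01 ab10 ab00 ab11 fab0 fab1 con.
have [conG degG pk] := classG.
pose G1 := move_edge b1 b0 a0.
pose G2 := @move_edge G1 a1 a0 b0.
have b0b1 : b0 != b1 by apply: contraTneq bb => ->; rewrite adj_irr.
have E1 (x y : G) : @adj G1 x y =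
    [|| adj x y && ~~ ((x == b0) && (y == b1) || (x == b1) && (y == b0)),
      (x == a0) && (y == b1) | (x == b1) && (y == a0)].
  by apply: move_edgeE.
have aa1 : @adj G1 a0 a1 by rewrite E1 aa (negbTE ab00) (negbTE ab01).
have nba : ~~ @adj G1 b0 a1.
  by rewrite E1 (negbTE b0a1) /= [b0 == a0]eq_sym (negbTE ab00) (negbTE b0b1).
have E2 (x y : G) : @adj G2 x y =
    [|| @adj G1 x y && ~~ ((x == a0) && (y == a1) || (x == a1) && (y == a0)),
      (x == b0) && (y == a1) | (x == a1) && (y == b0)].
  by apply: move_edgeE.
have csym2 := sym_connect_sym (@adj_sym G2).
have con1 : connect (@adj G1) b0 a0.
  apply: connect_sub con => x y /andP[xy h]; apply: connect1.
  by rewrite E1 xy /=; move: h; rewrite !negb_or => /and4P[-> ->].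
have con2 : connect (@adj G2) a0 b0.
  rewrite csym2; apply: connect_sub con => x y /andP[xy h]; apply: connect1.
  by rewrite E2 E1 xy /=; move: h; rewrite !negb_or => /and4P[-> -> -> ->].
have deg2 (x : G) : @degree G2 x = @degree G x.
  have h1 := degree_move_edge bb a0b1 ab01 x.
  have h2 := @degree_move_edge G1 a1 a0 b0 aa1 nba ab10 x.
  by apply/eqP; rewrite -(eqn_add2r (x == a0)) h2 h1.
have cl : unicyclic_class k G2.
  split.
  - apply: (@move_edge_connected G1) => //; apply: move_edge_connected => //.
  - by rewrite -degG; apply: eq_bigr => x _.
  - by rewrite -pk !card_pendantE; apply: eq_bigr => x _; rewrite deg2.
case/andP: halpha => alpha0 alpha1.
have le2 : quad (@aentry _ alpha G) f <= quad (@aentry _ alpha G2) f.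
  (* The gain is 2 (1 - alpha) (f b0 - f a0) (f a1 - f b1). *)
  rewrite (@quad_move_edge _ alpha G1) // quad_move_edge // -!addrA lerDl.
  have : 0 <= (1 - alpha) * ((f b0 - f a0) * (f a1 - f b1)).
    by rewrite mulr_ge0 ?mulr_ge0 ?subr_ge0 // ltW.
  lra.
have := extremal_aop cl le2 b1.
rewrite (@aop_move_edge _ alpha G1) // aop_move_edge //.
rewrite eqxx ![b1 == _]eq_sym (negbTE b0b1) (negbTE ab01) (negbTE ab11).
have : (1 - alpha) * (f a0 - f b0) < 0.
  by rewrite nmulr_llt0 ?subr_lt0 ?subr_gt0.
rewrite /= !mulr0n mulr1n !mul0r mul1r !subr0 !addr0 => lt0 /eqP.
by rewrite -subr_eq0 addrAC subrr add0r (lt_eqF lt0).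
Qed.

(** * Comparison of a pendant path with another walk leaving the root *)

Section TwoWalks.
Variables (q m : nat) (b a : nat -> G).
Hypotheses (b_root : b 0%N = v) (a_root : a 0%N = v).
Hypotheses (q_gt0 : (0 < q)%N) (m_ge3 : (2 < m)%N) (a3v : a 3 != v).
Hypothesis adj_b : forall i, (i < q)%N -> adj (b i) (b i.+1).
Hypothesis adj_a : forall i, (i < m)%N -> adj (a i) (a i.+1).
Hypothesis nbr_b : forall i y, (0 < i < q)%N -> adj (b i) y -> y = b i.-1 \/ y = b i.+1.
Hypothesis nbr_bq : forall y, adj (b q) y -> y = b q.-1.
Hypothesis nbr_a : forall i y, (0 < i < m)%N -> adj (a i) y -> y = a i.-1 \/ y = a i.+1.
Hypothesis inj_b : forall i j, (i <= q)%N -> (j <= q)%N -> b i = b j -> i = j.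
Hypothesis inj_a : forall i j, (i < m)%N -> (j < m)%N -> a i = a j -> i = j.
Hypothesis am_a : forall i, (0 < i < m)%N -> a m <> a i.
Hypothesis a_b : forall i j, (i <= m)%N -> (0 < j <= q)%N -> a i <> b j.
Hypothesis a_end : (q.+2 <= m)%N \/ a m = v.

Let a_neq_v i : (0 < i < m)%N -> a i != v.
Proof.
case/andP=> i0 im; apply/negP => /eqP; rewrite -a_root => /inj_a.
by move=> /(_ im (ltn_trans i0 im)) e; rewrite e in i0.
Qed.

Let a_neq_b i j : (0 < i < m)%N -> (j <= q)%N -> a i != b j.
Proof.
move=> im jq; case: (posnP j) => [->|j0]; first by rewrite b_root a_neq_v.
by apply/eqP/a_b; rewrite ?j0 //; case/andP: im => _ /ltnW.
Qed.

Let a_skip i : (i.+2 <= m)%N -> a i != a i.+2.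
Proof.
move=> im; apply/eqP; have [lt|ge] := ltnP i.+2 m.
  by move=> /inj_a -/(_ (ltnW (ltnW lt)) lt); lia.
have -> : i.+2 = m by apply/eqP; rewrite eqn_leq im.
by move/esym; apply: am_a; clear -im ge m_ge3; lia.
Qed.

(** For [s = 0] and [s = 1] this rests on [a 3 != v], which fails when [a] runs around a
    triangle. *)
Let b_nadj_a s : (s < q)%N -> (s.+2 <= m)%N -> ~~ adj (b s) (a s.+2).
Proof.
move=> sq sm; case: (posnP s) => [->|s0].
  rewrite b_root adj_sym; apply/negP => /(@nbr_a 2 _ m_ge3)[/= e|/= e].
    by have := @a_neq_v 1; rewrite -e eqxx => /(_ (ltn_trans (ltnSn 1) m_ge3)).
  by move: a3v; rewrite e eqxx.
apply/negP => /(@nbr_b s); rewrite s0 sq => /(_ isT)[] e; last first.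
  by case: (@a_b s.+2 s.+1).
case: (posnP s.-1) => [s1|s1].
  have es : s = 1%N by clear -s0 s1; lia.
  by move: a3v; rewrite es /= b_root in e; rewrite e eqxx.
by case: (@a_b s.+2 s.-1); rewrite // s1 /=; clear -sq; lia.
Qed.

Let b_connect (e : rel G) s : symmetric e -> (s <= q)%N ->
  (forall i, (i < s)%N -> e (b i) (b i.+1)) -> connect e (b s) v.
Proof.
move=> /sym_connect_sym csym sq H.
by rewrite csym -b_root; apply: connect_walk.
Qed.

Lemma walk_lt (s : nat) : (s <= q)%N -> (s.+1 <= m)%N -> f (a s.+1) < f (b s).
Proof.
elim: s => [|s IH] sq sm.
  have a1v : a 1 != v by apply: a_neq_v; rewrite (ltn_trans _ m_ge3).
  by rewrite b_root; apply: extremal_lt_max => //; exact: extremal_degree_le2.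
have {}IH := IH (ltnW sq) (ltnW sm).
rewrite ltNge; apply/negP => le.
have s1 : (0 < s.+1 < m)%N by rewrite sm.
have b1 : (0 < s.+1 <= q)%N by rewrite sq.
have na2b : a s.+2 != b s.+1 by apply/eqP/a_b.
have nb0a2 : b s != a s.+2.
  case: (posnP s) => [->|s0]; first by rewrite b_root eq_sym a_neq_v ?m_ge3.
  by rewrite eq_sym; apply/eqP/a_b => //; rewrite s0 ltnW.
have na1b : a s.+1 != b s.+1 by apply: a_neq_b.
have na1b0 : a s.+1 != b s by apply: a_neq_b => //; apply: ltnW.
apply: (@extremal_switch (b s) (b s.+1) (a s.+1) (a s.+2)) => //.
- exact: adj_b.
- exact: adj_a.
- apply/negP => /(nbr_a s1)[]/= e; last by rewrite e eqxx in na2b.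
  by case: (@a_b s s.+1) => //; rewrite ltnW // ltnW.
- exact: b_nadj_a.
set e := (X in connect X).
have se : symmetric e.
  move=> x y; rewrite /e /= adj_sym; congr (_ && ~~ _).
  by case: (x == b s); case: (x == b s.+1); case: (x == a s.+1); case: (x == a s.+2);
     case: (y == b s); case: (y == b s.+1); case: (y == a s.+1); case: (y == a s.+2).
(* The way from [b s] back to the root and out again to [a s.+1] uses neither of the two switched
   edges. *)
apply: (@connect_trans _ _ v).
  apply: b_connect (ltnW sq) _ => // i im; rewrite /e /=.
  have iq : (i < q)%N := ltn_trans im sq.
  have n1 : b i != b s.
    by apply/eqP => /inj_b e'; have := e' (ltnW iq) (ltnW sq); clear -im; lia.
  have n2 : b i != b s.+1.
    by apply/eqP => /inj_b e'; have := e' (ltnW iq) sq; clear -im; lia.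
  have n3 : b i != a s.+1 by rewrite eq_sym a_neq_b // ltnW.
  have n4 : b i.+1 != a s.+1 by rewrite eq_sym a_neq_b.
  by rewrite adj_b // (negbTE n1) (negbTE n2) (negbTE n3) (negbTE n4) andbF.
rewrite -a_root; apply: connect_walk => i im; rewrite /e /=.
have im' : (i.+1 < m)%N := leq_ltn_trans im sm.
have n1 : a i.+1 != b s.+1 by apply/eqP/a_b => //; apply: ltnW.
have n2 : a i != b s.+1 by apply/eqP/a_b => //; rewrite ltnW // ltnW.
have n3 : a i != a s.+1.
  by apply/eqP => /inj_a e'; have := e' (ltnW im') sm; clear -im; lia.
rewrite adj_a 1?ltnW // (negbTE n1) (negbTE n2) (negbTE n3) andbF /=.
move: im; rewrite ltnS leq_eqVlt => /orP[/eqP ->|im].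
  by rewrite (negbTE (a_skip _)).
rewrite negb_and; apply/orP; right.
by apply/eqP => /inj_a e'; have := e' im' sm; clear -im; lia.
Qed.

Lemma two_walks_absurd : False.
Proof.
(* If [a] does not outrun [b], it ends at [v], and [walk_lt] at [m.-1] puts a value above the
   maximum. *)
have [qm|] := leqP q.+2 m; last first.
  move=> mq; case: a_end => [|amv]; first by rewrite leqNgt mq.
  have m0 : (0 < m)%N by apply: ltn_trans m_ge3.
  have h : (m.-1 <= q)%N by clear -mq; lia.
  have := walk_lt h; rewrite prednK // amv => /(_ (leqnn m)).
  by rewrite ltNge max_f.
have q1m : (0 < q.+1 < m)%N by [].
have q2q : (0 < q <= q)%N by rewrite q_gt0 leqnn.
have nbqa : ~~ adj (b q) (a q.+2).
  apply/negP => /nbr_bq e; case: (posnP q.-1) => q1.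
    have eq1 : q = 1%N by clear -q_gt0 q1; lia.
    by move: a3v; rewrite eq1 /= b_root in e; rewrite e eqxx.
  by case: (@a_b q.+2 q.-1); rewrite // q1 /= leq_pred.
have bqa : b q != a q.+2 by rewrite eq_sym; apply/eqP/a_b.
have aqb : a q.+1 != b q by apply: a_neq_b.
have aa : adj (a q.+1) (a q.+2) by apply: adj_a.
(* Here [walk_lt] at [q] gives [f (a q.+1) < f (b q)], the inequality that the shift requires. *)
apply: (@extremal_shift (a q.+2) (a q.+1) (b q)) => //.
- by apply/ltW/walk_lt => //; apply: ltnW.
- set M := move_edge _ _ _.
  apply: (@connect_trans _ _ (v : M)).
    rewrite (sym_connect_sym (@adj_sym M)) -a_root; apply: connect_walk => i im.
    have im' : (i.+1 < m)%N := leq_ltn_trans im qm.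
    have n3 : a i != a q.+1.
      by apply/eqP => /inj_a e'; have := e' (ltnW im') qm; clear -im; lia.
    rewrite move_edgeE // adj_a 1?ltnW // (negbTE n3) /=; apply/orP; left.
    move: im; rewrite ltnS leq_eqVlt => /orP[/eqP ->|im].
      by rewrite (negbTE (a_skip _)).
    rewrite negb_and; apply/orP; right.
    by apply/eqP => /inj_a e'; have := e' im' qm; clear -im; lia.
  rewrite (sym_connect_sym (@adj_sym M)); apply: b_connect => //; first exact: (@adj_sym M).
  move=> i iq; have n3 : b i != a q.+1 by rewrite eq_sym a_neq_b // ltnW.
  have n4 : b i.+1 != a q.+1 by rewrite eq_sym a_neq_b.
  by rewrite move_edgeE // adj_b // (negbTE n3) (negbTE n4) andbF.
(* The two vertices exchange roles: [b q] goes from degree 1 to 2, and [a q.+1] from 2 to 1. *)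
- have [_ _ pk] := classG; rewrite -pk !card_pendantE.
  have deg_u : degree (a q.+1) = 2.
    apply/eqP; rewrite eqn_leq extremal_degree_le2 ?a_neq_v //=.
    have <- : #|[set a q; a q.+2]%SET| = 2 by rewrite cards2 a_skip.
    apply: subset_leq_card; apply/fintype.subsetP => y; rewrite !inE.
    by case/orP=> /eqP ->; rewrite // adj_sym adj_a // ltnW // ltnW.
  have deg_z : degree (b q) = 1%N.
    apply/eqP; rewrite eqn_leq; apply/andP; split.
      rewrite -(card1 (b q.-1)); apply: subset_leq_card.
      by apply/fintype.subsetP => y; rewrite !inE => /nbr_bq ->.
    apply/card_gt0P; exists (b q.-1); rewrite inE adj_sym.
    by have := @adj_b q.-1; rewrite prednK //; apply.
  set M := move_edge _ _ _.
  have : (\sum_x ((@degree M x == 1) + (x == b q))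
      = \sum_x ((@degree G x == 1) + (x == a q.+1)))%N.
    apply: eq_bigr => x _; have := degree_move_edge aa nbqa bqa x.
    have [->|xu] := eqVneq x (a q.+1).
      by rewrite deg_u (negbTE aqb) addn0 addn1 => -[->].
    have [->|xz] := eqVneq x (b q); first by rewrite deg_z addn0 => ->.
    by rewrite !addn0 => ->.
  by rewrite !big_split /= !sum_eq_op => /addIn.
Qed.

End TwoWalks.

(** * Shape of a maximizer: balanced legs and a triangle *)

Section ExtremalLegs.
Local Open Scope nat_scope.
Variables (d : G -> nat) (p : G -> G) (ca cb : G).
Hypothesis T : bfs v d p.
Hypotheses (chord : adj ca cb) (chordN : ~~ tree_adj v p ca cb).
Hypothesis adjE : forall x y, adj x y =
  [|| tree_adj v p x y, (x == ca) && (y == cb) | (x == cb) && (y == ca)].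

Local Notation leg := (leg d p).

Let degree_root : 1 < degree v.
Proof. exact/ltnW/extremal_max_degree. Qed.

(** A leg longer by at least 2 would outrun the shorter one, as in the first case of [a_end]. *)
Lemma extremal_legs_balanced z z' : pendant G z -> pendant G z' -> d z <= (d z').+1.
Proof.
move=> pz pz'; rewrite leqNgt; apply/negP => zz'.
have [ez za zb] := pendant_leg_end T chord chordN degree_root pz.
have [ez' za' zb'] := pendant_leg_end T chord chordN degree_root pz'.
have z'0 : 0 < d z' by rewrite lt0n (bfs_depth0 T); case: ez'.
have z3 : 2 < d z by apply: leq_trans zz'.
have zz : z != z' by apply: contraTneq zz' => ->; rewrite -leqNgt leqnSn.
apply: (@two_walks_absurd (d z') (d z) (leg z') (leg z)) => //.
- exact: (leg0 T).
- exact: (leg0 T).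
- exact: (leg_neq_root T).
- exact: (leg_adj T).
- exact: (leg_adj T).
- by move=> i y; apply: (leg_nbr T chord chordN adjE extremal_degree_le2).
- move=> y; rewrite leg_depth => /(leg_end_nbr adjE ez')[->|[e]|[e]].
  + by rewrite -parent_leg ?prednK // leg_depth.
  + by rewrite e eqxx in za'.
  + by rewrite e eqxx in zb'.
- by move=> i y; apply: (leg_nbr T chord chordN adjE extremal_degree_le2).
- by move=> i j; apply: (leg_inj T).
- by move=> i j /ltnW iz /ltnW jz; apply: (leg_inj T).
- move=> i /andP[i0 iz] /(leg_inj T (leqnn _) (ltnW iz)) e.
  by rewrite e ltnn in iz.
- move=> i j iz jz' e; case: (posnP i) => [i0|i0].
    by move: (leg_neq_root T jz'); rewrite -e i0 (leg0 T) eqxx.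
  suff e' : z = z' by rewrite e' eqxx in zz.
  by apply: (leg_end_inj T extremal_degree_le2) e; rewrite ?i0.
- by left.
Qed.

Lemma extremal_triangle : d ca = 1 /\ d cb = 1.
Proof.
have [_ _ pk] := classG.
have [z pz] : exists z, z \in pendant G by apply/card_gt0P; rewrite pk.
have [ez za zb] := pendant_leg_end T chord chordN degree_root pz.
have z0 : 0 < d z by rewrite lt0n (bfs_depth0 T); case: ez.
have ea := ca_end T chord chordN extremal_degree_le2.
have eb := cb_end T chord chordN extremal_degree_le2.
have a0 : 0 < d ca by rewrite lt0n (bfs_depth0 T); case: ea.
have b0 : 0 < d cb by rewrite lt0n (bfs_depth0 T); case: eb.
have ab := ca_neq_cb chord.
pose t := (d ca + d cb).+1.
suff : t <= 3 by move: a0 b0; rewrite /t; clear; lia.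
rewrite leqNgt; apply/negP => t4.
(* The walk [c] goes out to [ca], crosses the chord to [cb] and returns to the root, after [t] steps
   in all; it plays the closed walk, against the leg of any pendant vertex. *)
pose c i := if i <= d ca then leg ca i else leg cb (t - i).
have c0 : c 0 = v by rewrite /c (leg0 T).
have ct : c t = v.
  by rewrite /c subnn (leg0 T) ifF //; apply/negbTE; rewrite -ltnNge ltnS leq_addr.
have cv i : 0 < i < t -> c i != v.
  move=> it; rewrite /c; case: leqP => ia; apply: (leg_neq_root T).
    by rewrite ia andbT; case/andP: it.
  by move: it ia; rewrite /t; clear; lia.
have c_leg i : 0 < i < t ->
    exists x j, [/\ leg_end v p x, x = ca \/ x = cb, 0 < j <= d x & c i = leg x j].
  move=> it; rewrite /c; case: leqP => ia.
    by exists ca, i; split=> //; [left|rewrite ia andbT; case/andP: it].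
  by exists cb, (t - i); split=> //; [right|move: it ia; rewrite /t; clear; lia].
apply: (@two_walks_absurd (d z) t (leg z) c) => //.
- exact: (leg0 T).
- exact: ltnW.
- exact: cv.
- exact: (leg_adj T).
- move=> i it; rewrite /c; have [ia|ia|ia] := ltngtP i (d ca).
  + exact: (leg_adj T).
  + have lt : (t - i.+1).+1 <= d cb by move: it ia; rewrite /t; clear; lia.
    have -> : t - i = (t - i.+1).+1 by rewrite subnSK.
    by rewrite adj_sym; apply: (leg_adj T).
  + rewrite ia leg_depth; have -> : t - (d ca).+1 = d cb by rewrite /t subSS addKn.
    by rewrite leg_depth.
- by move=> i y; apply: (leg_nbr T chord chordN adjE extremal_degree_le2).
- move=> y; rewrite leg_depth => /(leg_end_nbr adjE ez)[->|[e]|[e]].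
  + by rewrite -parent_leg ?prednK // leg_depth.
  + by rewrite e eqxx in za.
  + by rewrite e eqxx in zb.
- move=> i y /andP[i0 it]; rewrite /c.
  have [ia|ia|ia] := ltngtP i (d ca).
  + rewrite (leq_trans (leq_pred i) (ltnW ia)).
    by apply: (leg_nbr T chord chordN adjE extremal_degree_le2) => //; rewrite i0.
  + have [ib|ib] := ltnP (t - i) (d cb); last first.
      have ei : i = (d ca).+1 by move: ib ia it; rewrite /t; clear; lia.
      have -> : t - i = d cb by rewrite ei /t subSS addKn.
      rewrite leg_depth => /(leg_end_nbr adjE eb)[->|[e]|[_ ->]].
      * right; have -> : t - i.+1 = (d cb).-1 by rewrite ei /t; clear; lia.
        by rewrite -[in RHS]parent_leg ?prednK // leg_depth.
      * by rewrite e eqxx in ab.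
      * by left; rewrite ei /= leqnn leg_depth.
    have ti : 0 < t - i by rewrite subn_gt0.
    have -> : i.-1 <= d ca = false by move: ib ia it; rewrite /t; clear; lia.
    case/(leg_nbr T chord chordN adjE extremal_degree_le2); rewrite ?ti // => ->;
      [right|left]; congr leg; move: i0 it; clear; lia.
  + rewrite ia leg_depth => /(leg_end_nbr adjE ea)[->|[_ ->]|[e]].
    * by left; rewrite leq_pred -[in RHS]parent_leg ?prednK // leg_depth.
    * right; have -> : t - (d ca).+1 = d cb by rewrite /t subSS addKn.
      by rewrite leg_depth.
    * by rewrite e eqxx in ab.
- by move=> i j; apply: (leg_inj T).
- move=> i j it jt.
  case: (posnP i) => [->|i0].
    case: (posnP j) => [->//|j0]; rewrite c0 => e.
    by have := cv j; rewrite j0 jt -e eqxx => /(_ isT).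
  case: (posnP j) => [->|j0].
    by rewrite c0 => e; have := cv i; rewrite i0 it e eqxx => /(_ isT).
  have ib : d ca < i -> 0 < t - i <= d cb by move: it; rewrite /t; clear; lia.
  have jb : d ca < j -> 0 < t - j <= d cb by move: jt; rewrite /t; clear; lia.
  rewrite /c; case: leqP => ia; case: leqP => ja e.
  + exact: (leg_inj T) e.
  + have e' : ca = cb by apply: (leg_end_inj T extremal_degree_le2) e; rewrite ?i0 ?ia ?jb.
    by rewrite e' eqxx in ab.
  + have e' : cb = ca by apply: (leg_end_inj T extremal_degree_le2) e; rewrite ?j0 ?ja ?ib.
    by rewrite e' eqxx in ab.
  + have [_ tib] := andP (ib ia); have [_ tjb] := andP (jb ja).
    have := leg_inj T tib tjb e; move: it jt; clear; lia.
- by move=> i it; rewrite ct => e; have := cv i it; rewrite -e eqxx.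
- move=> i j it jz e.
  have [iv|iv] := eqVneq (c i) v.
    by move: (leg_neq_root T jz); rewrite -e iv eqxx.
  have it' : 0 < i < t.
    rewrite lt0n; apply/andP; split; first by apply: contraNneq iv => ->; rewrite c0.
    by rewrite ltn_neqAle it andbT; apply: contraNneq iv => ->; rewrite ct.
  have [x [j' [ex xab j'x ec]]] := c_leg i it'.
  have xz : x = z by apply: (leg_end_inj T extremal_degree_le2 ex ez j'x jz); rewrite -ec.
  by case: xab => e'; move: za zb; rewrite -xz e' eqxx.
- by right.
Qed.

Lemma extremal_giso : giso (U #|G| 3 k) G.
Proof.
have [_ _ pk] := classG.
have [dca dcb] := extremal_triangle.
have [h0 [h0_inj h0_pendant h0_cover]] : exists h : 'I_k -> G,
    [/\ injective h, forall i, pendant G (h i) &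
        forall z, pendant G z -> exists i, z = h i].
  rewrite -pk; exists enum_val; split.
  - exact: enum_val_inj.
  - by move=> i; apply: (enum_valP i).
  - by move=> z pz; exists (enum_rank_in pz z); rewrite enum_rankK_in.
(* Used twice: with [h0], to count the total length of the legs, and with [h0 \o s], which lists
   them in the order of [path_len]. *)
have iso (h : 'I_k -> G) := @leg_map_giso G v d p ca cb T chord chordN adjE
  extremal_degree_le2 degree_root dca dcb k h.
have sum_d : \sum_i d (h0 i) = #|G| - 3.
  have [g bijg _] := iso h0 h0_inj h0_pendant h0_cover.
  by rewrite -(bij_eq_card bijg) card_cycle_paths addKn.
have [s s_inj sE] := balanced_path_len k_gt0
  (fun i j => extremal_legs_balanced (h0_pendant i) (h0_pendant j)).
have := iso (h0 \o s); rewrite /U.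
have -> : (fun i => d ((h0 \o s) i)) = @path_len (#|G| - 3) k.
  by apply/funext => i; rewrite /= sE sum_d.
apply.
- exact: inj_comp.
- by move=> i; apply: h0_pendant.
- move=> z /h0_cover[i ->]; have [s' _ s'K] := injF_bij s_inj.
  by exists (s' i); rewrite /= s'K.
Qed.

End ExtremalLegs.

End Extremal.

(** * Existence and identification of the maximizers *)

Section Maximizer.
Local Open Scope nat_scope.
Variables (R : realType) (alpha : R) (k : nat).
Hypotheses (halpha : (0 <= alpha < 1)%R) (k_gt0 : 0 < k).

Lemma class_maximizer_giso (G : sgraph) : unicyclic_class k G ->
  (forall e : rel G, unicyclic_class k (graph_of_rel e) ->
     (rho alpha (graph_of_rel e) <= rho alpha G)%R) ->
  giso (U #|G| 3 k) G.
Proof.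
move=> classG maxG; have [conG degG pk] := classG.
have [x0 _] : exists x0, x0 \in pendant G by apply/card_gt0P; rewrite pk.
have G0 : 0 < #|G| by apply/card_gt0P; exists x0.
have [f f_gt0 eq_f] := perron halpha G0 conG.
have [v max_f] : exists v, forall x, (f x <= f v)%R.
  by case: (@arg_maxP _ _ _ x0 predT f isT) => v _ h; exists v => x; apply: h.
have [d [p T]] := bfs_exists v conG.
have [ca [cb [chord chordN adjE]]] := unique_chord T degG.
exact: (extremal_giso halpha k_gt0 classG maxG f_gt0 eq_f max_f T chord chordN adjE).
Qed.

(** Relations are coded as sets of pairs, a finite type on which a maximum exists; [G] shows that
    the class is inhabited. *)
Lemma class_maximizer_exists (G : sgraph) : unicyclic_class k G ->
  exists2 e0 : rel G, unicyclic_class k (graph_of_rel e0) &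
    forall e : rel G, unicyclic_class k (graph_of_rel e) ->
      (rho alpha (graph_of_rel e) <= rho alpha (graph_of_rel e0))%R.
Proof.
move=> classG.
pose r (E : {set G * G}) : rel G := fun x y => (x, y) \in E.
have rK (e : rel G) : r [set u | e u.1 u.2]%SET = e.
  by apply/funext => x; apply/funext => y; rewrite /r inE.
pose P E := `[< unicyclic_class k (graph_of_rel (r E)) >].
have P0 : P [set u | adj u.1 u.2]%SET by apply/asboolP; rewrite rK graph_of_adj.
case: (@arg_maxP _ _ _ _ P (fun E => rho alpha (graph_of_rel (r E))) P0).
move=> E /asboolP clE maxE; exists (r E); first exact: clE.
move=> e cle; have := maxE [set u | e u.1 u.2]%SET; rewrite rK; apply.
by apply/asboolP; rewrite rK.
Qed.

End Maximizer.

Theorem theorem3p5 (R : realType) (alpha : R) (n k : nat) (G : sgraph)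
    (halpha : 0 <= alpha < 1)
    (hk : (1 <= k <= n - 3)%N)
    (huni : unicyclic G)
    (hn : #|G| = n)
    (hpend : #|pendant G| = k) :
  rho alpha G <= rho alpha (U n 3 k) /\
  (rho alpha G = rho alpha (U n 3 k) <-> giso G (U n 3 k)).
Proof.
have k_gt0 : (0 < k)%N by case/andP: hk.
have classG : unicyclic_class k G.
  by split=> //; [case: huni | exact: unicyclic_sum_degree].
have [e0 class0 max0] := class_maximizer_exists alpha classG.
(* The radius of [U n 3 k] is maximal because some maximizer is isomorphic to it. *)
have rho0 : rho alpha (graph_of_rel e0) = rho alpha (U n 3 k).
  by apply/esym/giso_rho; rewrite -hn; apply: (class_maximizer_giso halpha k_gt0 class0).
split; first by rewrite -rho0; have := max0 (@adj G); rewrite graph_of_adj; apply.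
split=> [eqG|]; last exact: giso_rho.
(* In the case of equality [G] is itself a maximizer, so the same identification applies to it. *)
have maxG (e : rel G) : unicyclic_class k (graph_of_rel e) ->
    rho alpha (graph_of_rel e) <= rho alpha G.
  by rewrite eqG -rho0; apply: max0.
by apply: giso_sym; rewrite -hn; exact: (class_maximizer_giso halpha k_gt0 classG maxG).
Qed.
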